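(* Assume that $d_*\ge0$ and that $f_j>0$ for all $j\ge0$. Then: (1) if there exists $j_0\ge0$ such that $$\sum_{j=j_0}^{\infty}-m_0\cdot\ldots\cdot m_{j-1}\cdot\log\varphi_{0,j}\Big(1-\frac1{\underline\sigma_{j+1}}\Big)<\infty,$$ then $\mathbb P(\Theta=\emptyset)>0$; (2) if $\mathbb P(\Theta=\emptyset)>0$, then either $d_*=0$ or $$\sum_{j=0}^{\infty}-m_0\cdot\ldots\cdot m_{j-1}\cdot\log\varphi_{0,j}\Big(1-\frac1{\overline\sigma_{j+1}}\Big)<\infty.$$
   Context: Tree. $\mathbb N=\{1,2,\ldots\}$; $\mathcal U$ is the set of finite words over $\mathbb N$, including the empty word $\varnothing$; $\langle u\rangle$ is the length (generation) of $u$; for $u\ne\varnothing$, $\pi(u)$ is $u$ with its last letter removed. Fix integers $m_j\ge 2$ ($j\ge 0$). For $j\ge 0$, $\mathcal U_j=\{u\in\mathcal U:\ u_i\le m_{j+i-1}\text{ for }1\le i\le\langle u\rangle\}$ and $\mathcal U_j^*=\mathcal U_j\setminus\{\varnothing\}$. For $u\in\mathcal U_0$, $u\,\mathcal U_{\langle u\rangle}$ (resp. $u\,\mathcal U_{\langle u\rangle}^*$) is the set of concatenations of $u$ with words of $\mathcal U_{\langle u\rangle}$ (resp. $\mathcal U_{\langle u\rangle}^*$). Compacts. Fix $d\ge 1$, reals $0<\underline\beta\le\overline\beta<1$, and for each $j\ge0$ a probability measure $\mu_j$ on $[\underline\beta,\overline\beta]^{m_j}$. $(J_u)_{u\in\mathcal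 U_0}$ is a random family of compact subsets of $\mathbb R^d$ with positive diameters $|J_u|$, such that: (A) for each $u\in\mathcal U_0$, the sets $J_{uk}$, $1\le k\le m_{\langle u\rangle}$, are subsets of $J_u$ with disjoint interiors; (B) there is a real $\kappa>0$ such that for each $u\in\mathcal U_0$ the Lebesgue measure of the interior of $J_u$ is at least $\kappa|J_u|^d$; (C) the ratios $L_u=|J_u|/|J_{\pi(u)}|$, $u\in\mathcal U_0^*$, are random variables and the vectors $(L_{uk})_{1\le k\le m_{\langle u\rangle}}$, $u\in\mathcal U_0$, are independent with respective distributions $\mu_{\langle u\rangle}$. Markov chain. For $j\ge0$ and $t\in\{0,1\}$ let $\nu_{t,j}$ be a probability measure on $\{0,1\}^{m_j}$. $(X_u)_{u\in\mathcal U_0}$ is a family of $\{0,1\}$-valued random variables, independent of $(L_u)_{u\in\mathcal U_0^*}$, such that for every $u\in\mathcal U_0$ and $A\subseteq\{0,1\}^{m_{\langle u\rangle}}$, $\mathbb P\big((X_{uk})_{1\le k\le m_{\langle u\rangle}}\in A\mid \mathcal G_u\big)=\nu_{X_u,\langle u\rangle}(A)$, where $\mathcal G_u=\sigma(X_v,\ v\in\mathcal U_0\setminus(u\,\mathcal U^*_{\langle u\rangle}))$. The set $\Theta$. Almost surely, for every sequence $\zeta=(\zeta_j)_{j\ge1}$ in $\mathbb N$ with $\zeta_1\ldots\zeta_j\in\mathcal U_0$ for all $j\ge 1$, the set $\bigcap_{j\ge1}J_{\zeta_1\ldots\zeta_j}$ is a single point, denoted $x_\zeta$. For $u\in\mathcal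 U_0$ let $\tau_u=\{v\in u\,\mathcal U_{\langle u\rangle}:\ X_{v_1\ldots v_j}=1\text{ for all }\langle u\rangle\le j\le\langle v\rangle\}$, $\partial\tau_u=\{\zeta\in\mathbb N^{\mathbb N}:\ \zeta_1\ldots\zeta_j\in\tau_u\text{ for all }j\ge\langle u\rangle\}$, $K_u=\{x_\zeta:\zeta\in\partial\tau_u\}$, and $\Theta=\bigcup_{u\in\mathcal U_0}K_u$. The number $d_*$. For $s\in\mathbb R$ and $j\ge0$, $\alpha_{s,j}=\int_{\{0,1\}^{m_j}}\int_{[\underline\beta,\overline\beta]^{m_j}}\sum_{k=1}^{m_j}\ell_k^s x_k\,\mu_j(d\ell)\,\nu_{1,j}(dx)$. Let $\underline j=\inf\{j_0\ge0:\ \alpha_{0,j}>0\ \text{for all } j\ge j_0\}$ (with $\inf\emptyset=\infty$). If $\underline j=\infty$, $d_*=-\infty$. Otherwise let $\rho(s)=\liminf_{j\to\infty}\frac1j\sum_{n=\underline j}^{j-1}\log\alpha_{s,n}$ for $s\in\mathbb R$ ($\rho$ is either identically $-\infty$ or a decreasing bijection of $\mathbb R$ onto $\mathbb R$) and $d_*=\sup\{s\in\mathbb R:\rho(s)>0\}=\inf\{s\in\mathbb R:\rho(s)<0\}\in[-\infty,\infty)$. Generating functions. For $t\in\{0,1\}$ and $j\ge0$, $\varphi_{t,j}(z)=\int_{\{0,1\}^{m_j}}z^{x_1+\cdots+x_{m_j}}\,\nu_{t,j}(dx)$ (with $0^0=1$); note $\varphi_{1,j}'(1)=\alpha_{0,j}$.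 For $j\ge 0$, $f_j=\lim_{n\to\infty}\varphi_{1,j}\circ\cdots\circ\varphi_{1,j+n}(0)$ (a nondecreasing limit). The sequences $\underline\sigma_j,\overline\sigma_j$. For $j\ge\underline j$, $$\underline\sigma_j=\max\Big(1,\ \sum_{n=j}^\infty\frac{\varphi_{1,n}'(1)+\varphi_{1,n}(0)-1}{\varphi_{1,n}'(1)\prod_{\ell=j}^n\varphi_{1,\ell}'(1)}+\limsup_{n\to\infty}\frac1{\prod_{\ell=j}^n\varphi_{1,\ell}'(1)}\Big),$$ $$\overline\sigma_j=\sum_{n=j}^\infty\frac{\varphi_{1,n}''(1)}{\varphi_{1,n}'(1)\prod_{\ell=j}^n\varphi_{1,\ell}'(1)}+\liminf_{n\to\infty}\frac1{\prod_{\ell=j}^n\varphi_{1,\ell}'(1)},$$ with values in $[1,\infty]$, and $\underline\sigma_j=\overline\sigma_j=\infty$ for $j<\underline j$. Conventions: $1/\infty=0$, $-\log 0=\infty$, and the empty product $m_0\cdots m_{j-1}$ for $j=0$ equals $1$. *)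

(* Defs.v *)
(* MathComp / MathComp-Analysis *)
From HB Require Import structures.
From mathcomp Require Import all_boot all_order all_algebra.
From mathcomp Require Import all_classical all_reals all_analysis.
From mathcomp Require Import measurable_realfun.

Set Implicit Arguments.
Unset Strict Implicit.
Unset Printing Implicit Defensive.

Import Order.TTheory GRing.Theory Num.Theory.
Import numFieldNormedType.Exports.

Local Open Scope classical_set_scope.
Local Open Scope ring_scope.

(* A word over {1, 2, ...} is a [seq nat] with positive letters; its
   generation is its [size], its prefix of length j is [take j u].  Letters
   are 1-based, but the list positions and the coordinates of a vector indexed
   by the children of u are 0-based: coordinate [k : 'I_(m (size u))] belongs
   to the child [rcons u k.+1]. *)

Definition tree_words (m : nat -> nat) (j : nat) : set (seq nat) :=
  [set u | forall i, (i < size u)%N -> (1 <= nth 0%N u i <= m (j + i))%N].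

Definition tree_words_star (m : nat -> nat) (j : nat) : set (seq nat) :=
  tree_words m j `\ [::].

Definition subtree (m : nat -> nat) (u : seq nat) : set (seq nat) :=
  [set u ++ w | w in tree_words m (size u)].

Definition subtree_star (m : nat -> nat) (u : seq nat) : set (seq nat) :=
  [set u ++ w | w in tree_words_star m (size u)].

Definition parent (u : seq nat) : seq nat := take (size u).-1 u.

Definition children (T : Type) (m : nat -> nat) (Omega : Type)
    (Y : seq nat -> Omega -> T) (u : seq nat) (w : Omega) :
    (m (size u)).-tuple T :=
  [tuple Y (rcons u k.+1) w | k < m (size u)].

Section euclidean_space.
Context {R : realType} {d : nat}.
Implicit Types (A : set 'rV[R]_d) (x y a b : 'rV[R]_d).

Definition eucl_dist x y : R :=
  Num.sqrt (\sum_(i < d) (x ord0 i - y ord0 i) ^+ 2).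

Definition diam A : R := sup [set eucl_dist p.1 p.2 | p in A `*` A].

Definition box a b : set 'rV[R]_d :=
  [set x | forall i, a ord0 i < x ord0 i <= b ord0 i].

(* Lebesgue outer measure on R^d, defined on all sets; it is the Lebesgue
   measure on measurable sets, and it is only applied to open sets below. *)
Definition lebesgue_outer A : \bar R :=
  ereal_inf [set s | exists a b : nat -> 'rV[R]_d,
    [/\ forall n i, a n ord0 i <= b n ord0 i,
        A `<=` \bigcup_n box (a n) (b n) &
        s = (\sum_(0 <= n <oo)
               (\prod_(i < d) (b n ord0 i - a n ord0 i))%:E)%E]].

End euclidean_space.

Section probability_notions.
Context {R : realType} {dO : measure_display} {Omega : measurableType dO}.
Variable P : probability Omega R.

(* The sets {Y_v \in B}, v in D: they generate the sigma-algebra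
   sigma(Y_v, v in D), which is thus [<<s events D Y >>]. *)
Definition events (I : Type) (dT : measure_display) (T : measurableType dT)
    (D : set I) (Y : I -> Omega -> T) : set (set Omega) :=
  [set E | exists v B, [/\ D v, measurable B & E = Y v @^-1` B]].

Definition independent_sigma (F G : set (set Omega)) : Prop :=
  forall A B, <<s F >> A -> <<s G >> B -> P (A `&` B) = (P A * P B)%E.

Definition mutually_independent (I : choiceType) (dT : I -> measure_display)
    (T : forall i, measurableType (dT i)) (D : set I)
    (Y : forall i, Omega -> T i) : Prop :=
  forall (s : seq I) (B : forall i, set (T i)),
    uniq s -> [set` s] `<=` D -> (forall i, measurable (B i)) ->
    P (\bigcap_(i in [set` s]) (Y i @^-1` B i)) =
    (\big[mule/1%E]_(i <- s) P (Y i @^-1` B i))%E.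

(* [f] is a version of the conditional probability of [E] given [<<s F >>]. *)
Definition is_cond_prob (F : set (set Omega)) (E : set Omega)
    (f : Omega -> \bar R) : Prop :=
  @measurable_fun _ _ (g_sigma_algebraType F) _ setT f
  /\ forall B, <<s F >> B -> (\int[P]_(w in B) f w)%E = P (E `&` B).

End probability_notions.

Definition cube {R : realType} (beta1 beta2 : R) (n : nat) :
    set (n.-tuple R) :=
  [set l | forall k, beta1 <= tnth l k <= beta2].
Arguments cube {R} beta1 beta2 n _.

Section model.
Context {R : realType} {dO : measure_display} {Omega : measurableType dO}.
Variables (P : probability Omega R) (m : nat -> nat).

Definition diam_ratio (d : nat) (J : seq nat -> Omega -> set 'rV[R]_d)
    (u : seq nat) (w : Omega) : R :=
  diam (J u w) / diam (J (parent u) w).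

Record random_compacts (d : nat)
    (mu : forall j, probability ((m j).-tuple R) R)
    (J : seq nat -> Omega -> set 'rV[R]_d) : Prop := RandomCompacts {
  rc_compact : forall u w, tree_words m 0 u -> compact (J u w);
  rc_diam : forall u w, tree_words m 0 u -> 0 < diam (J u w);
  rc_nested : forall u w k, tree_words m 0 u -> (1 <= k <= m (size u))%N ->
    J (rcons u k) w `<=` J u w;
  rc_disjoint : forall u w k l, tree_words m 0 u ->
    (1 <= k <= m (size u))%N -> (1 <= l <= m (size u))%N -> k <> l ->
    (J (rcons u k) w)° `&` (J (rcons u l) w)° = set0;
  rc_volume : exists2 kappa : R, 0 < kappa & forall u w, tree_words m 0 u ->
    ((kappa * diam (J u w) ^+ d)%:E <= lebesgue_outer (J u w)°)%E;
  rc_measurable : forall u, tree_words_star m 0 u ->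
    measurable_fun [set: Omega] (diam_ratio J u);
  rc_indep : mutually_independent P (tree_words m 0)
    (fun u => children m (diam_ratio J) u);
  rc_law : forall u (B : set ((m (size u)).-tuple R)),
    tree_words m 0 u -> measurable B ->
    P (children m (diam_ratio J) u @^-1` B) = mu (size u) B
}.

Record tree_markov_chain
    (nu : bool -> forall j, probability ((m j).-tuple bool) R)
    (X : seq nat -> Omega -> bool) : Prop := TreeMarkovChain {
  mc_measurable : forall u, tree_words m 0 u ->
    measurable_fun [set: Omega] (X u);
  mc_transition : forall u (A : set ((m (size u)).-tuple bool)),
    tree_words m 0 u ->
    is_cond_prob P (events (tree_words m 0 `\` subtree_star m u) X)
      (children m X u @^-1` A) (fun w => nu (X u w) (size u) A)
}.

Definition tau (X : seq nat -> Omega -> bool) (u : seq nat) (w : Omega) :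
    set (seq nat) :=
  [set v | subtree m u v /\
    forall j, (size u <= j <= size v)%N -> X (take j v) w].

(* The sequence (zeta_1, zeta_2, ...) is represented by [zeta : nat -> nat]
   with [zeta i] = zeta_{i+1}, so that its prefix of length j is
   [mkseq zeta j]. *)
Definition tau_boundary (X : seq nat -> Omega -> bool) (u : seq nat)
    (w : Omega) : set (nat -> nat) :=
  [set zeta | forall j, (size u <= j)%N -> tau X u w (mkseq zeta j)].

(* The intersection is a single point for all zeta, almost surely; it is in
   any case nonempty under [random_compacts], and [get] then selects one of
   its points. *)
Definition limit_point (d : nat) (J : seq nat -> Omega -> set 'rV[R]_d)
    (zeta : nat -> nat) (w : Omega) : 'rV[R]_d :=
  get (\bigcap_(j in [set j | (1 <= j)%N]) J (mkseq zeta j) w).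

Definition K_set (d : nat) (J : seq nat -> Omega -> set 'rV[R]_d)
    (X : seq nat -> Omega -> bool) (u : seq nat) (w : Omega) :
    set 'rV[R]_d :=
  [set limit_point J zeta w | zeta in tau_boundary X u w].

Definition Theta (d : nat) (J : seq nat -> Omega -> set 'rV[R]_d)
    (X : seq nat -> Omega -> bool) (w : Omega) : set 'rV[R]_d :=
  \bigcup_(u in tree_words m 0) K_set J X u w.

End model.

Section characteristics.
Context {R : realType} {m : nat -> nat}.
Variables (beta1 beta2 : R) (mu : forall j, probability ((m j).-tuple R) R)
  (nu : bool -> forall j, probability ((m j).-tuple bool) R).

Definition alpha (s : R) (j : nat) : \bar R :=
  (\int[nu true j]_x \int[mu j]_(l in cube beta1 beta2 (m j))
     (\sum_(k < m j) tnth l k `^ s * (tnth x k)%:R)%:E)%E.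

Definition eventually_alpha_pos (j0 : nat) : Prop :=
  forall j, (j0 <= j)%N -> (0 < alpha 0 j)%E.

(* The least [j0] such that [eventually_alpha_pos j0]; [None] encodes the
   value infinity. *)
Definition j_under : option nat :=
  match pselect (exists j0, `[< eventually_alpha_pos j0 >]) with
  | left exj0 => Some (ex_minn exj0)
  | right _ => None
  end.

(* [lne] is the logarithm on [0, +oo], with [lne 0 = -oo]. *)
Definition rho (j0 : nat) (s : R) : \bar R :=
  limn_einf (fun j => (j%:R^-1)%:E * \sum_(j0 <= n < j) lne (alpha s n))%E.

Definition d_star : \bar R :=
  if j_under is Some j0
  then ereal_sup [set s%:E | s in [set s : R | (0 < rho j0 s)%E]]
  else -oo%E.

Definition phi (t : bool) (j : nat) (z : R) : R :=
  \int[nu t j]_x z ^+ (\sum_(k < m j) tnth x k)%N.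

Fixpoint phi_comp (j n : nat) (z : R) : R :=
  if n is n'.+1 then phi true j (phi_comp j.+1 n' z) else z.

Definition f_ext (j : nat) : R := limn (fun n => phi_comp j n.+1 0).

Definition phi1' (n : nat) : R := derive1 (phi true n) 1.
Definition phi1'' (n : nat) : R := derive1n 2 (phi true n) 1.

Definition mean_prod (j n : nat) : R := \prod_(j <= l < n.+1) phi1' l.

Definition before_j_under (j : nat) : bool :=
  if j_under is Some j0 then (j < j0)%N else true.

Definition sigma_under (j : nat) : \bar R :=
  if before_j_under j then +oo%E else
  maxe 1%E
    (\sum_(j <= n <oo)
        ((phi1' n + phi true n 0 - 1) / (phi1' n * mean_prod j n))%:E
     + limn_esup (fun n => (mean_prod j n)^-1%:E))%E.

Definition sigma_over (j : nat) : \bar R :=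
  if before_j_under j then +oo%E else
  (\sum_(j <= n <oo) (phi1'' n / (phi1' n * mean_prod j n))%:E
   + limn_einf (fun n => (mean_prod j n)^-1%:E))%E.

(* Term of index j of the series of the theorem, for sigma one of the two
   sequences above.  The extended inverse satisfies [+oo^-1 = 0] and sigma
   takes its values in [1, +oo], so [fine] is applied to a real number. *)
Definition series_term (sigma : nat -> \bar R) (j : nat) : \bar R :=
  (((\prod_(i < j) m i)%N%:R)%:E *
   - lne ((phi false j (1 - fine (sigma j.+1)^-1))%:E))%E.

End characteristics.

(* Main.v *)
Require Import Defs.
From mathcomp Require Import all_boot all_order all_algebra.
From mathcomp Require Import all_classical all_reals all_analysis.
From mathcomp Require Import measurable_realfun.
From mathcomp Require Import ring lra zify.

Set Implicit Arguments.
Unset Strict Implicit.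
Unset Printing Implicit Defensive.

Import Order.TTheory GRing.Theory Num.Theory.
Import numFieldNormedType.Exports.

Local Open Scope classical_set_scope.
Local Open Scope ring_scope.

(** Every infinite cluster of ones contributes a point to [Theta], so [Theta]
is empty if and only if no ray of the tree is eventually labelled by ones. By
Koenig's lemma ([alive_ray], [Theta_eq0]) this means that, for every n, the
clusters of ones started from generation n are finite ([clusters_finite n]).

Let N_n and Z_n be the numbers of ones and of zeros in generation n, and M_n
their sum. A cluster started from a one of generation n is a branching process
in varying environment, finite with probability [f_ext n], and the branching
property ([branching_step], [prob_clusters_finite]) gives
  y_n := P (clusters_finite n) = E [f_n ^ N_n],
  y_(n+1) = E [c_n ^ Z_n * f_n ^ N_n], with c_n = phi_(0,n) (f_(n+1)).
Everything is read off these two identities; the series to consider is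
sum_n M_n * - log c_n.

(1) Since Z_n <= M_n, y_(n+1) >= c_n ^ M_n * y_n. If the series converges, the
y_n stay above a positive constant ([clusters_finite_gt0]).

(2) Let h be M_n / 2 rounded up. Either N_n >= h or Z_n >= h, hence
y_(n+1) <= c_n ^ h * y_n + (1 - c_n ^ h) * f_n ^ h. If the limit of the y_n is
positive and f_n ^ h tends to 0, the sum of the differences y_n - y_(n+1)
controls the series ([clusters_finite_summable]). That f_n ^ h tends to 0 means
that M_n (1 - f_n) tends to infinity, and here the hypothesis d_* > 0 is used:
it makes the mean population tend to infinity ([d_star_gt0_growth]), and then
the second moment bound on 1 / (1 - f_n) is of order o (M_n) as soon as
one of the numbers sigma_over is finite ([survival_large]). If all of them are
infinite, all the terms of the series in the statement vanish.

It remains to compare: 1 - 1 / sigma_under_j <= f_j <= 1 - 1 / sigma_over_j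
([sigma_le_f_ext], [f_ext_le_sigma]). Both come from two-sided bounds, with the
same slope 1 / phi', for the inverse survival probability
1 / (1 - phi z) as a function of 1 / (1 - z) ([pgf_survival_lower],
[pgf_survival_upper]), iterated along the generations. *)

(** * Bounds on the inverse survival probability over one generation *)

Section generating_function_bounds.
Context {R : realFieldType}.
Implicit Types (z la : R).

Lemma exprn_survival_le z n : 0 <= z <= 1 -> z ^+ n * (1 + n%:R * (1 - z)) <= 1.
Proof.
move=> /andP[z0 z1]; elim: n => [|n IH]; first by rewrite expr0 mul0r addr0 mulr1.
apply: le_trans IH; rewrite exprSr -mulrA.
apply: ler_wpM2l; first exact: exprn_ge0.
rewrite -natr1 -subr_ge0.
set x := n%:R; have x0 : 0 <= x by [].
have -> : 1 + x * (1 - z) - z * (1 + (x + 1) * (1 - z)) =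
  (x + 1) * (1 - z) ^+ 2 by ring.
by rewrite mulr_ge0 ?sqr_ge0// addr_ge0.
Qed.

(** If T of n individuals survive, each with probability [1 - z], this is the
mean of the inequality 1_(T > 0) >= 2 la T - la^2 T^2, which holds because
(1 - la T)^2 >= 0. *)
Lemma second_moment_pointwise z la n : 0 <= z <= 1 ->
  2 * la * (1 - z) * n%:R -
    la ^+ 2 * ((1 - z) ^+ 2 * (n * n.-1)%:R + (1 - z) * n%:R) <= 1 - z ^+ n.
Proof.
move=> z01; have /andP[z0 z1] := z01.
case: n => [|n]; first by rewrite mul0n !mulr0 addr0 mulr0 subr0 expr0 subrr.
rewrite /= natrM [z ^+ n.+1]exprS; have := exprn_survival_le n z01.
have y1 : z ^+ n <= 1 by exact: exprn_ile1.
have n0 : 0 <= n%:R :> R by [].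
rewrite -[n.+1%:R]natr1; move: (z ^+ n) (n%:R) n0 y1 => y x x0 y1 H.
have p0 : 0 <= 1 - z by lra.
have zp : 1 - (1 - z) = z by lra.
set y' := 1 - z * y.
have Hy : (x + 1) * (1 - z) <= y' * (1 + x * (1 - z)).
  by have := ler_wpM2l z0 H; rewrite /y'; lra.
move: (1 - z) p0 Hy => p p0 Hy.
set t := (x + 1) * p.
have -> : 2 * la * p * (x + 1) = 2 * la * t by rewrite /t; ring.
have -> : p ^+ 2 * ((x + 1) * x) + p * (x + 1) = t * (1 + x * p).
  by rewrite /t; ring.
have t0 : 0 <= t by rewrite mulr_ge0 ?addr_ge0.
have q0 : 1 <= 1 + x * p by rewrite lerDl mulr_ge0.
move: (1 + x * p) q0 Hy => q q0 Hy; rewrite -/t in Hy.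
(* multiplied by q, the claim is the sum of Hy and of this square *)
have : 0 <= t * (1 - la * q) ^+ 2 by apply: mulr_ge0 => //; exact: sqr_ge0.
move=> H2; rewrite -subr_ge0 -(@pmulr_lge0 _ q); last by lra.
lra.
Qed.

(** For n >= 1 the right-hand side is the chord through n = 1 and n = 2 of
[1 - z ^+ n], which is concave in n. *)
Lemma chord_pointwise z n : 0 <= z <= 1 ->
  1 - z ^+ n <= (1 - (n == 0%N)%:R) * (1 - z) ^+ 2 + (1 - z) * z * n%:R.
Proof.
move=> z01; have /andP[z0 z1] := z01.
elim: n => [|n IH]; first by rewrite expr0 subrr !mulr0 mul0r addr0.
rewrite /= [z ^+ n.+1]exprS -[n.+1%:R]natr1 subr0 mul1r.
case: n IH => [|n] /= IH; first by rewrite expr0; lra.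
have yz : z ^+ n.+1 <= z by rewrite exprS ler_piMr// exprn_ile1.
rewrite subr0 mul1r in IH; move: (z ^+ n.+1) (n.+1%:R) yz IH => y x yz IH.
have p0 : 0 <= 1 - z by rewrite subr_ge0.
have := ler_wpM2l p0 yz; lra.
Qed.

Variables (T : finType) (a : T -> R) (c : T -> nat).
Hypotheses (a_ge0 : forall x, 0 <= a x) (a_sum1 : \sum_x a x = 1).

Let G z := \sum_x a x * z ^+ c x.
Let mean := \sum_x a x * (c x)%:R.
Let fact2 := \sum_x a x * (c x * (c x).-1)%:R.

Let survE z : 1 - G z = \sum_x a x * (1 - z ^+ c x).
Proof.
by rewrite -[X in X - _]a_sum1 -sumrB; apply: eq_bigr => x _; rewrite mulrBr mulr1.
Qed.

(** Averaging [second_moment_pointwise] and optimising over la gives the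
Cauchy-Schwarz bound P (T > 0) >= (E T)^2 / E T^2 for the number T of
survivors. *)
Lemma pgf_survival_lower z : 0 <= z <= 1 -> 0 < mean -> z < 1 ->
  (1 - G z)^-1 <= fact2 / mean ^+ 2 + (mean * (1 - z))^-1.
Proof.
move=> z01 mean_gt0 z1.
have p0 : 0 < 1 - z by rewrite subr_gt0.
have F0 : 0 <= fact2 by apply: sumr_ge0 => x _; rewrite mulr_ge0.
have key la : 2 * la * (1 - z) * mean -
    la ^+ 2 * ((1 - z) ^+ 2 * fact2 + (1 - z) * mean) <= 1 - G z.
  rewrite survE /mean /fact2 !mulr_sumr -big_split /= mulr_sumr -sumrB.
  apply: ler_sum => x _.
  have /(ler_wpM2l (a_ge0 x)) := second_moment_pointwise la (c x) z01.
  lra.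
pose B := (1 - z) ^+ 2 * fact2 + (1 - z) * mean.
have B0 : 0 < B.
  by rewrite /B ltr_wpDl// ?mulr_gt0// mulr_ge0// sqr_ge0.
pose t := (1 - z) * mean; have t0 : 0 < t by rewrite mulr_gt0.
have {key} := key (t / B); rewrite -/B.
have -> : 2 * (t / B) * (1 - z) * mean - (t / B) ^+ 2 * B = t ^+ 2 / B.
  by rewrite /t; field; rewrite gt_eqF.
have -> : fact2 / mean ^+ 2 + (mean * (1 - z))^-1 = (t ^+ 2 / B)^-1.
  by rewrite /t /B; field; rewrite !gt_eqF// -/B.
move=> H; rewrite lef_pV2 ?posrE// ?divr_gt0 ?exprn_gt0//.
by apply: lt_le_trans H; rewrite divr_gt0 ?exprn_gt0.
Qed.

(** With p = 1 - z, q = 1 - G 0 and d = p (mean - q), averaging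
[chord_pointwise] gives 1 - G z <= p (mean - d), while the left-hand side of
the claim is (mean + d) / (mean^2 p); so the bound is
(mean - d) (mean + d) <= mean^2. *)
Lemma pgf_survival_upper z : 0 <= z <= 1 -> 0 < mean -> G z < 1 -> z < 1 ->
  (mean + G 0 - 1) / mean ^+ 2 + (mean * (1 - z))^-1 <= (1 - G z)^-1.
Proof.
move=> z01 mean_gt0 Gz1 z1.
have p0 : 0 < 1 - z by rewrite subr_gt0.
have key : 1 - G z <= (1 - G 0) * (1 - z) ^+ 2 + (1 - z) * z * mean.
  rewrite !survE /mean mulr_suml mulr_sumr -big_split /=.
  apply: ler_sum => x _.
  have /(ler_wpM2l (a_ge0 x)) := chord_pointwise (c x) z01.
  rewrite expr0n; lra.
rewrite -[leRHS]mul1r ler_pdivlMr ?subr_gt0//.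
have -> : (mean + G 0 - 1) / mean ^+ 2 + (mean * (1 - z))^-1 =
  (mean + (1 - z) * (mean + G 0 - 1)) / (mean ^+ 2 * (1 - z)).
  by field; rewrite !gt_eqF.
rewrite mulrAC ler_pdivrMr ?mulr_gt0// ?exprn_gt0// mul1r.
have q1 : 0 <= mean + G 0 - 1.
  rewrite -addrA -opprB survE /mean -sumrB sumr_ge0// => x _.
  rewrite expr0n -mulrBr mulr_ge0//; case: (c x) => [|n] /=; first by lra.
  by rewrite subr0 subr_ge0 ler1n.
have Y0 : 0 <= mean + (1 - z) * (mean + G 0 - 1).
  by apply: addr_ge0; [exact: ltW|apply: mulr_ge0 => //; exact: ltW].
rewrite mulrC; apply: le_trans (ler_wpM2r Y0 key) _.
rewrite -subr_ge0.
have -> : mean ^+ 2 * (1 - z) - ((1 - G 0) * (1 - z) ^+ 2 + (1 - z) * z * mean) *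
  (mean + (1 - z) * (mean + G 0 - 1)) = (1 - z) ^+ 3 * (mean + G 0 - 1) ^+ 2.
  by ring.
by rewrite mulr_ge0 ?sqr_ge0// exprn_ge0// ltW.
Qed.

End generating_function_bounds.

(** * Integrals over the finite set of offspring vectors *)

Lemma measurable_tuple_bool n (A : set (n.-tuple bool)) : measurable A.
Proof.
have -> : A = \bigcup_(x in A) \bigcap_(i in [set: 'I_n])
    ((fun y : n.-tuple bool => tnth y i) @^-1` [set tnth x i]).
  apply/seteqP; split=> [x Ax|y [x Ax xy]]; first by exists x.
  by have <- : x = y by apply: eq_from_tnth => i; rewrite (xy i).
apply: fin_bigcup_measurable => [|x _]; first exact: finite_finset.
apply: fin_bigcap_measurable => [|i _]; first exact: finite_finset.
by rewrite -[X in measurable X]setTI; exact: measurable_tnth.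
Qed.

Lemma measurable_fun_tuple_bool n d (T : measurableType d)
  (f : n.-tuple bool -> T) : measurable_fun setT f.
Proof. by move=> _ Y _; exact: measurable_tuple_bool. Qed.

Lemma integral_tuple_bool (R : realType) n
    (nu : probability (n.-tuple bool) R) (f : n.-tuple bool -> R) :
  (\int[nu]_x (f x)%:E = (\sum_x f x * fine (nu [set x]))%:E)%E.
Proof.
have {1}-> : [set: n.-tuple bool] =
    \big[setU/set0]_(x <- index_enum _) [set x : n.-tuple bool].
  by apply/seteqP; split => // x _; rewrite -bigcup_seq; exists x => //=;
    rewrite mem_index_enum.
rewrite integral_bigsetU_EFin.
- rewrite -sumEFin; apply: eq_bigr => x _.
  rewrite (eq_integral (cst (f x)%:E)); last by move=> y; rewrite inE => ->.
  rewrite integral_cst//; last exact: measurable_tuple_bool.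
  rewrite EFinM fineK// fin_num_measure//; exact: measurable_tuple_bool.
- by move=> x; exact: measurable_tuple_bool.
- exact: index_enum_uniq.
- apply/trivIsetP => x y _ _ xy; rewrite -subset0 => z [/= ->] /eqP.
  by rewrite (negbTE xy).
- apply: measurable_funTS; exact: measurable_fun_tuple_bool.
Qed.

Section offspring.
Context {R : realType} {m : nat -> nat}.
Variable nu : bool -> forall j, probability ((m j).-tuple bool) R.
Implicit Types (t : bool) (j n : nat) (z : R).

Definition weight t j (x : (m j).-tuple bool) : R := fine (nu t j [set x]).

Lemma weight_ge0 t j x : 0 <= @weight t j x.
Proof. exact: fine_ge0. Qed.

Lemma weight_sum1 t j : \sum_x @weight t j x = 1.
Proof.
apply: EFin_inj; rewrite -(@probability_setT _ _ _ (nu t j)).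
rewrite -[RHS]mul1e -integral_cst//.
rewrite (integral_tuple_bool (nu t j) (cst 1)).
by congr (_%:E); apply: eq_bigr => x _; rewrite mul1r.
Qed.

Let ones j (x : (m j).-tuple bool) : nat := (\sum_(k < m j) tnth x k)%N.

Lemma phiE t j z : phi nu t j z = \sum_x @weight t j x * z ^+ ones x.
Proof.
rewrite /phi /Rintegral (integral_tuple_bool _ (fun x => z ^+ ones x)) /=.
by apply: eq_bigr => x _; rewrite mulrC.
Qed.

Let pgf t j : {poly R} := \sum_x @weight t j x *: 'X^(ones x).

Let phi_pgf t j : phi nu t j = horner (pgf t j).
Proof.
apply/funext => z; rewrite phiE /pgf horner_sum.
by apply: eq_bigr => x _; rewrite hornerZ hornerXn.
Qed.

Lemma phi_continuous t j : continuous (phi nu t j).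
Proof. by rewrite phi_pgf; exact: continuous_horner. Qed.

Lemma phi1'E j : phi1' nu j = \sum_x @weight true j x * (ones x)%:R.
Proof.
rewrite /phi1' phi_pgf -derivE /pgf raddf_sum horner_sum.
apply: eq_bigr => x _.
by rewrite /= derivZ derivXn hornerZ hornerMn hornerXn expr1n.
Qed.

Lemma phi1''E j :
  phi1'' nu j = \sum_x @weight true j x * (ones x * (ones x).-1)%:R.
Proof.
rewrite /phi1'' phi_pgf /derive1n /= -!derivE /pgf !raddf_sum horner_sum.
apply: eq_bigr => x _.
rewrite /= derivZ derivXn derivZ derivMn derivXn hornerZ !hornerMn hornerXn expr1n.
by rewrite -mulrnA mulnC.
Qed.

Lemma phi1'_ge0 j : 0 <= phi1' nu j.
Proof. by rewrite phi1'E sumr_ge0// => x _; rewrite mulr_ge0// weight_ge0. Qed.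

Lemma phi1''_ge0 j : 0 <= phi1'' nu j.
Proof. by rewrite phi1''E sumr_ge0// => x _; rewrite mulr_ge0// weight_ge0. Qed.

Lemma phi1'_le j : phi1' nu j <= (m j)%:R.
Proof.
rewrite phi1'E -[leRHS]mul1r -[X in X * _](weight_sum1 true j) mulr_suml.
apply: ler_sum => x _.
rewrite ler_wpM2l ?weight_ge0// ler_nat -[leqRHS]card_ord -sum1_card.
by apply: leq_sum => k _; exact: leq_b1.
Qed.

Lemma phi_ge0 t j z : 0 <= z -> 0 <= phi nu t j z.
Proof.
move=> z0; rewrite phiE sumr_ge0// => x _.
by rewrite mulr_ge0 ?weight_ge0// exprn_ge0.
Qed.

Lemma phi_le t j z z' : 0 <= z -> z <= z' -> phi nu t j z <= phi nu t j z'.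
Proof.
move=> z0 zz'; rewrite !phiE ler_sum// => x _.
by rewrite ler_wpM2l ?weight_ge0// lerXn2r// ?nnegrE// (le_trans z0).
Qed.

Lemma phi_at1 t j : phi nu t j 1 = 1.
Proof.
rewrite phiE -[RHS](weight_sum1 t j); apply: eq_bigr => x _.
by rewrite expr1n mulr1.
Qed.

Lemma phi_le1 t j z : 0 <= z <= 1 -> phi nu t j z <= 1.
Proof. by move=> /andP[z0 z1]; rewrite -(phi_at1 t j); exact: phi_le. Qed.

Lemma phi_gt0 t j z : 0 < z -> 0 < phi nu t j z.
Proof.
move=> z0; rewrite lt0r phi_ge0 ?ltW// andbT phiE.
apply/negP; rewrite psumr_eq0; last first.
  by move=> x _; rewrite mulr_ge0 ?weight_ge0// exprn_ge0// ltW.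
move=> /allP w0; have := weight_sum1 t j.
rewrite big1 => [/eqP|x _]; first by rewrite eq_sym oner_eq0.
have /= := w0 x (mem_index_enum _).
by rewrite mulf_eq0 expf_eq0 [z == 0]gt_eqF// andbF orbF => /eqP.
Qed.

Lemma phi_lt1 j z : 0 <= z -> z < 1 -> 0 < phi1' nu j -> phi nu true j z < 1.
Proof.
move=> z0 z1; apply: contraTT; rewrite -!leNgt => le1.
have le0 : \sum_x @weight true j x * (1 - z ^+ ones x) <= 0.
  under eq_bigr do rewrite mulrBr mulr1.
  by rewrite sumrB weight_sum1 -phiE subr_le0.
have ge0 x : 0 <= @weight true j x * (1 - z ^+ ones x).
  by rewrite mulr_ge0 ?weight_ge0// subr_ge0 exprn_ile1// ltW.
have /eqP : \sum_x @weight true j x * (1 - z ^+ ones x) = 0.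
  by apply/eqP; rewrite eq_le le0 sumr_ge0.
rewrite psumr_eq0// => /allP /= w0.
rewrite phi1'E big1// => x _; have := w0 x (mem_index_enum _).
rewrite mulf_eq0 => /orP[/eqP ->|]; first by rewrite mul0r.
rewrite subr_eq0; case: (ones x) => [|n]; first by rewrite mulr0.
move=> /eqP e; have : z ^+ n.+1 < 1 by rewrite exprn_ilt1.
by rewrite -e ltxx.
Qed.

Lemma phi_survival_lower j z : 0 <= z -> z < 1 -> 0 < phi1' nu j ->
  (1 - phi nu true j z)^-1 <=
    phi1'' nu j / phi1' nu j ^+ 2 + (phi1' nu j * (1 - z))^-1.
Proof.
move=> z0 z1; rewrite phiE phi1''E phi1'E => mu0.
apply: pgf_survival_lower => //; [exact: weight_ge0|exact: weight_sum1|].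
by rewrite z0 ltW.
Qed.

Lemma phi_survival_upper j z : 0 <= z -> z < 1 -> 0 < phi1' nu j ->
  (phi1' nu j + phi nu true j 0 - 1) / phi1' nu j ^+ 2 +
    (phi1' nu j * (1 - z))^-1 <= (1 - phi nu true j z)^-1.
Proof.
move=> z0 z1 mu0; have := phi_lt1 z0 z1 mu0; move: mu0.
rewrite !phiE phi1'E => mu0 G1.
apply: pgf_survival_upper => //; [exact: weight_ge0|exact: weight_sum1|].
by rewrite z0 ltW.
Qed.

Lemma phi1'_phi0_ge1 j : 0 <= phi1' nu j + phi nu true j 0 - 1.
Proof.
rewrite -addrA -opprB subr_ge0 -[X in X - _](weight_sum1 true j).
rewrite phi1'E phiE -sumrB ler_sum// => x _.
rewrite -[X in X - _]mulr1 -mulrBr ler_wpM2l ?weight_ge0//.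
rewrite expr0n; case: (ones x) => [|n] /=; first by rewrite subrr.
by rewrite subr0 ler1n.
Qed.

End offspring.

(** * Extinction of the clusters of ones *)

Section extended_limits.
Context {R : realType}.
Implicit Types (u : (\bar R)^nat) (c : \bar R).

Lemma le_limn_einf u c n0 :
  (forall n, (n0 <= n)%N -> c <= u n)%E -> (c <= limn_einf u)%E.
Proof.
move=> cu; rewrite limn_einf_lim; apply: lime_ge; first exact: is_cvg_einfs.
near=> n; apply: le_ereal_inf_tmp => _ [k /= nk <-]; apply: cu.
by apply: leq_trans nk; near: n; exists n0.
Unshelve. all: by end_near. Qed.

Lemma limn_esup_le u c n0 :
  (forall n, (n0 <= n)%N -> u n <= c)%E -> (limn_esup u <= c)%E.
Proof.
move=> uc; rewrite limn_esup_lim; apply: lime_le; first exact: is_cvg_esups.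
near=> n; apply: ge_ereal_sup => _ [k /= nk <-]; apply: uc.
by apply: leq_trans nk; near: n; exists n0.
Unshelve. all: by end_near. Qed.

Lemma nneseries_le (a : nat -> R) j (r : \bar R) :
  (forall n, (j <= n)%N -> 0 <= a n) ->
  (forall n, (\sum_(j <= l < n) a l)%:E <= r)%E ->
  (\sum_(j <= n <oo) (a n)%:E <= r)%E.
Proof.
move=> a0 ar; apply: lime_le.
  by apply: is_cvg_nneseries => n jn _; rewrite lee_fin a0.
by apply: nearW => n; rewrite sumEFin.
Qed.

End extended_limits.

Section extinction_of_clusters.
Context {R : realType} {m : nat -> nat}.
Variable nu : bool -> forall j, probability ((m j).-tuple bool) R.
Implicit Types (j n k : nat) (z : R).

Lemma phi_comp01 j k z : 0 <= z <= 1 -> 0 <= phi_comp nu j k z <= 1.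
Proof.
move=> z01; elim: k j => [//|k IH] j /=.
by have /andP[z0 z1] := IH j.+1; rewrite phi_ge0// phi_le1// z0.
Qed.

Lemma phi_comp_le j k z z' : 0 <= z -> z <= z' -> z' <= 1 ->
  phi_comp nu j k z <= phi_comp nu j k z'.
Proof.
move=> z0 zz' z'1; have z01 : 0 <= z <= 1 by rewrite z0 (le_trans zz').
elim: k j => [//|k IH] j /=; apply: phi_le => //.
by case/andP: (phi_comp01 j.+1 k z01).
Qed.

Lemma phi_compSr j k z :
  phi_comp nu j k.+1 z = phi_comp nu j k (phi nu true (j + k) z).
Proof.
elim: k j => [|k IH] j; first by rewrite /= addn0.
by rewrite [LHS]/= -/(phi_comp _ _ k.+1 _) IH addSnnS.
Qed.

Lemma phi_comp_nd j : nondecreasing_seq (fun k => phi_comp nu j k 0).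
Proof.
apply/nondecreasing_seqP => k; rewrite phi_compSr.
by apply: phi_comp_le; rewrite ?phi_ge0// phi_le1// lexx ler01.
Qed.

Let zero01 : 0 <= (0 : R) <= 1.
Proof. by rewrite lexx ler01. Qed.

Lemma phi_comp_cvg j : phi_comp nu j k 0 @[k --> \oo] --> f_ext nu j.
Proof.
rewrite /f_ext -[X in X @ \oo --> _]/(fun k => phi_comp nu j k 0).
have /cvg_ex[l ul] : cvgn (fun k => phi_comp nu j k 0).
  apply: nondecreasing_is_cvgn; first exact: phi_comp_nd.
  by exists 1 => _ [k _ <-]; case/andP: (phi_comp01 j k zero01).
suff -> : limn (fun n => phi_comp nu j n.+1 0) = l by [].
apply: cvg_lim => //; move: ul; by rewrite -cvg_shiftS.
Qed.

Lemma phi_comp_le_f j k : phi_comp nu j k 0 <= f_ext nu j.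
Proof.
have cv := @phi_comp_cvg j; rewrite -(cvg_lim _ cv)//.
by apply: (nondecreasing_cvgn_le (@phi_comp_nd j)); apply/cvg_ex; exists (f_ext nu j).
Qed.

Lemma f_ext_le j z : (forall k, phi_comp nu j k 0 <= z) -> f_ext nu j <= z.
Proof.
move=> H; have cv := @phi_comp_cvg j; rewrite -(cvg_lim _ cv)//.
by apply: limr_le; [apply/cvg_ex; exists (f_ext nu j)|exact: nearW].
Qed.

Lemma f_ext_ge0 j : 0 <= f_ext nu j.
Proof. by have := phi_comp_le_f j 0. Qed.

Lemma f_ext_le1 j : f_ext nu j <= 1.
Proof. by apply: f_ext_le => k; case/andP: (phi_comp01 j k zero01). Qed.

Lemma f_ext_rec j : f_ext nu j = phi nu true j (f_ext nu j.+1).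
Proof.
have cv := @phi_comp_cvg j; have := @phi_comp_cvg j.+1.
move/(continuous_cvg _ (@phi_continuous _ _ nu true j _)) => cv'.
move: cv; rewrite -cvg_shiftS => cv.
exact: (cvg_unique _ cv cv').
Qed.

(** Renormalising by the mean turns the one-generation bounds, which relate
the inverses of the survival probabilities at j and j + 1 by an affine map of
slope [1 / phi1' j], into sums. *)
Definition mean_upto j n : R := \prod_(j <= l < n) phi1' nu l.

Definition psum (a : nat -> R) j n : R :=
  \sum_(j <= l < n) a l / (phi1' nu l * mean_prod nu j l).

Lemma mean_prodE j n : mean_prod nu j n = mean_upto j n.+1.
Proof. by []. Qed.

Lemma mean_upto_rec j n : (j < n)%N ->
  mean_upto j n = phi1' nu j * mean_upto j.+1 n.
Proof. by move=> jn; rewrite /mean_upto big_ltn. Qed.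

Lemma mean_upto_cat j k n : (j <= k <= n)%N ->
  mean_upto j n = mean_upto j k * mean_upto k n.
Proof. by move=> /andP[jk kn]; rewrite /mean_upto (big_cat_nat jk). Qed.

Lemma psum_rec a j n : (j < n)%N ->
  psum a j n = a j / phi1' nu j ^+ 2 + psum a j.+1 n / phi1' nu j.
Proof.
move=> jn; rewrite /psum big_ltn// mean_prodE mean_upto_rec//.
rewrite {1}/mean_upto big_geq// mulr1 -expr2; congr (_ + _).
rewrite mulr_suml; apply: eq_big_nat => l /andP[jl ln].
rewrite !mean_prodE (@mean_upto_rec j)// ?(leq_trans jl)// !invfM; ring.
Qed.

Section positive_means.
Variable j0 : nat.
Hypothesis mean_gt0 : forall n, (j0 <= n)%N -> 0 < phi1' nu n.

Lemma mean_upto_gt0 j n : (j0 <= j)%N -> 0 < mean_upto j n.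
Proof.
move=> j0j; rewrite /mean_upto big_nat prodr_gt0// => l /andP[jl _].
by rewrite mean_gt0// (leq_trans j0j).
Qed.

Lemma phi_comp_lt1 j k : (j0 <= j)%N -> phi_comp nu j k 0 < 1.
Proof.
elim: k j => [|k IH] j j0j //=.
apply: phi_lt1; last exact: mean_gt0.
  by case/andP: (phi_comp01 j.+1 k zero01).
by rewrite IH// leqW.
Qed.

Let phi_comp0_step j k : (j0 <= j)%N ->
  [/\ 0 <= phi_comp nu j k 0, phi_comp nu j k 0 < 1 & 0 < phi1' nu j].
Proof.
move=> j0j; split; [|exact: phi_comp_lt1|exact: mean_gt0].
by case/andP: (phi_comp01 j k zero01).
Qed.

(** Both sides are 1 for k = 0, and [psum_rec] and [mean_upto_rec] are the
recursion given by [phi_survival_lower]. *)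
Lemma inv_survival_le j k : (j0 <= j)%N ->
  (1 - phi_comp nu j k 0)^-1 <=
    psum (phi1'' nu) j (j + k) + (mean_upto j (j + k))^-1.
Proof.
elim: k j => [|k IH] j j0j.
  by rewrite addn0 /= /psum /mean_upto !big_geq// subr0 add0r.
have mu0 := mean_gt0 j0j; have [z0 z1 _] := phi_comp0_step k (leqW j0j).
apply: le_trans (phi_survival_lower z0 z1 mu0) _.
have jk : (j < j + k.+1)%N by rewrite addnS ltnS leq_addr.
rewrite psum_rec// mean_upto_rec// -addrA lerD2l.
have invM (a b : R) : (a * b)^-1 = b^-1 / a by rewrite invfM mulrC.
rewrite [X in X <= _]invM [X in _ <= _ + X]invM -mulrDl -addSnnS.
by apply: ler_wpM2r; [rewrite invr_ge0 ltW|exact: IH (leqW j0j)].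
Qed.

Lemma inv_survival_ge j k : (j0 <= j)%N ->
  psum (fun n => phi1' nu n + phi nu true n 0 - 1) j (j + k) +
    (mean_upto j (j + k))^-1 <= (1 - phi_comp nu j k 0)^-1.
Proof.
elim: k j => [|k IH] j j0j.
  by rewrite addn0 /= /psum /mean_upto !big_geq// subr0 add0r.
have mu0 := mean_gt0 j0j; have [z0 z1 _] := phi_comp0_step k (leqW j0j).
apply: le_trans (phi_survival_upper z0 z1 mu0).
have jk : (j < j + k.+1)%N by rewrite addnS ltnS leq_addr.
rewrite psum_rec// mean_upto_rec// -addrA lerD2l.
have invM (a b : R) : (a * b)^-1 = b^-1 / a by rewrite invfM mulrC.
rewrite [X in _ <= X]invM [X in _ + X <= _]invM -mulrDl -addSnnS.
by apply: ler_wpM2r; [rewrite invr_ge0 ltW|exact: IH (leqW j0j)].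
Qed.

Let summand_ge0 (a : nat -> R) j : (forall n, 0 <= a n) -> (j0 <= j)%N ->
  forall n, (j <= n)%N -> 0 <= a n / (phi1' nu n * mean_prod nu j n).
Proof.
move=> a0 j0j n jn; rewrite divr_ge0// mulr_ge0// ?phi1'_ge0//.
by rewrite mean_prodE ltW// mean_upto_gt0.
Qed.

Lemma psum_le (a : nat -> R) j n k : (forall n, 0 <= a n) -> (j0 <= j)%N ->
  (j <= n)%N -> (n <= k)%N -> psum a j n <= psum a j k.
Proof.
move=> a0 j0j jn nk; rewrite /psum (big_cat_nat jn nk) /= lerDl.
rewrite big_nat sumr_ge0// => l /andP[nl _].
by apply: summand_ge0 => //; exact: leq_trans nl.
Qed.

(** The inverse survival probabilities increase to [1 / (1 - f_ext nu j)], so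
the bounds of [inv_survival_le] at all later generations apply to each of them,
and the lower limit of these bounds too. *)
Lemma f_ext_le_sigma j : (j0 <= j)%N ->
  f_ext nu j <= 1 - fine (\sum_(j <= n <oo)
      (phi1'' nu n / (phi1' nu n * mean_prod nu j n))%:E
    + limn_einf (fun n => (mean_prod nu j n)^-1%:E))^-1 <= 1.
Proof.
move=> j0j; set T := (\sum_(j <= n <oo) _)%E; set L := limn_einf _.
have s0 := summand_ge0 (phi1''_ge0 nu) j0j.
have T0 : (0 <= T)%E by apply: nneseries_ge0 => n jn _; rewrite lee_fin s0.
have L0 : (0 <= L)%E.
  apply: (@le_limn_einf _ _ _ 0%N) => n _.
  by rewrite lee_fin invr_ge0 mean_prodE ltW// mean_upto_gt0.
have psumT n : ((psum (phi1'' nu) j n)%:E <= T)%E.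
  by rewrite -sumEFin; apply: nneseries_lim_ge => l jl _; rewrite lee_fin s0.
have HS k : (((1 - phi_comp nu j k 0)^-1)%:E <= T + L)%E.
  case: (T) T0 psumT => [t| |] // T0 psumT; last first.
    by rewrite addye ?leey// -ltNye (lt_le_trans _ L0)// ltNy0.
  rewrite -leeBlDl//; apply: (@le_limn_einf _ _ _ (j + k)) => n jkn.
  rewrite -EFinB lee_fin lerBlDl mean_prodE.
  have jn : (j <= n)%N by apply: leq_trans jkn; exact: leq_addr.
  have := inv_survival_le (n.+1 - j) j0j.
  rewrite subnKC ?leqW// => H.
  apply: le_trans (le_trans _ H) _; last by rewrite lerD2r -lee_fin.
  have lt k' := @phi_comp_lt1 j k' j0j.
  rewrite lef_pV2 ?posrE ?subr_gt0// lerD2l lerN2; apply: phi_comp_nd.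
  by rewrite leq_subRL leqW// -addnS.
have S0 : (0 <= T + L)%E by exact: adde_ge0.
apply/andP; split; last by rewrite gerBl fine_ge0// inve_ge0.
case: (T + L)%E HS {S0} => [s| |] HS.
- have s0' : 0 < s.
    have := HS 0%N; rewrite /= subr0 invr1 lee_fin; exact: lt_le_trans.
  rewrite fine_invr; apply: f_ext_le => k.
  have := HS k; rewrite lee_fin -[X in _ <= X]invrK.
  rewrite lef_pV2 ?posrE ?invr_gt0 ?subr_gt0 ?phi_comp_lt1//; lra.
- by rewrite invey /= subr0 f_ext_le1.
- by have := HS 0%N; rewrite leeNy_eq.
Qed.

(** Dually, all the lower bounds of [inv_survival_ge] are below
[1 / (1 - f_ext nu j)]. *)
Lemma sigma_le_f_ext j : (j0 <= j)%N ->
  0 <= 1 - fine (maxe 1%E (\sum_(j <= n <oo)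
      ((phi1' nu n + phi nu true n 0 - 1) /
        (phi1' nu n * mean_prod nu j n))%:E
    + limn_esup (fun n => (mean_prod nu j n)^-1%:E))%E)^-1 <= f_ext nu j.
Proof.
move=> j0j; set T := (\sum_(j <= n <oo) _)%E; set L := limn_esup _.
have a0 n : 0 <= phi1' nu n + phi nu true n 0 - 1 by exact: phi1'_phi0_ge1.
have s0 := summand_ge0 a0 j0j.
have T0 : (0 <= T)%E by apply: nneseries_ge0 => n jn _; rewrite lee_fin s0.
have L0 : (0 <= L)%E.
  apply: le_trans (limn_einf_sup _); apply: (@le_limn_einf _ _ _ 0%N) => n _.
  by rewrite lee_fin invr_ge0 mean_prodE ltW// mean_upto_gt0.
set S := maxe _ _; have S1 : (1 <= S)%E by rewrite /S le_max lexx.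
have V1 : 0 <= fine (S^-1) <= 1.
  move: S1; case: (S) => [s| |].
  - rewrite fine_invr lee_fin => s1.
    by rewrite invr_ge0 invf_le1 ?(lt_le_trans _ s1)// s1 (le_trans _ s1).
  - by rewrite invey /= lexx ler01.
  - by rewrite leeNy_eq.
case/andP: V1 => V0 V1; rewrite subr_ge0 V1 /=.
have := f_ext_le1 j; rewrite le_eqVlt => /predU1P[->|f1].
  by rewrite lerBlDr lerDl.
have f1' : 0 < 1 - f_ext nu j by rewrite subr_gt0.
pose r := (1 - f_ext nu j)^-1.
have Hk n : (j <= n)%N -> psum (fun n => phi1' nu n + phi nu true n 0 - 1) j n +
    (mean_upto j n)^-1 <= r.
  move=> jn; have := inv_survival_ge (n - j) j0j; rewrite subnKC// => H.
  apply: (le_trans H); rewrite lef_pV2 ?posrE ?subr_gt0 ?phi_comp_lt1//.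
  by rewrite lerD2l lerN2 phi_comp_le_f.
have HL k : (L <= (r - psum (fun n => phi1' nu n + phi nu true n 0 - 1) j k)%:E)%E.
  apply: (@limn_esup_le _ _ _ (j + k)) => n jkn.
  have jn : (j <= n.+1)%N by rewrite leqW// (leq_trans _ jkn)// leq_addr.
  have := Hk _ jn; rewrite lee_fin mean_prodE lerBrDl; apply: le_trans.
  rewrite lerD2r; have [kj|jk] := leqP k j.
    rewrite /psum (big_geq kj) big_nat sumr_ge0// => l /andP[jl _]; exact: s0.
  by apply: psum_le => //; [exact: ltnW|rewrite leqW// (leq_trans _ jkn)// leq_addl].
have Lfin : L \is a fin_num.
  by rewrite ge0_fin_numE// (le_lt_trans (HL 0%N))// ltry.
have HT : (T + L <= r%:E)%E.
  rewrite -leeBrDr//; apply: nneseries_le => // n.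
  rewrite leeBrDr// -leeBrDl// -EFinB; exact: HL.
have : (S <= r%:E)%E.
  rewrite /S ge_max HT andbT lee_fin /r invf_ge1//.
  by have := f_ext_ge0 j; lra.
move: S1; case: (S) => [s| |]//; rewrite !lee_fin fine_invr => s1.
have s0' : 0 < s by exact: lt_le_trans s1.
rewrite -[X in X <= _ -> _]invrK lef_pV2 ?posrE ?invr_gt0//; lra.
Qed.

(** The bound of [inv_survival_le] started from generation n is the mean
population at n times the sum of two terms: the tail from n on of a convergent
series, and the inverse of a later mean population. *)
Lemma survival_large (M : nat -> R) (t : R) :
  (forall n, (j0 <= n)%N -> 0 < M n /\ mean_upto j0 n <= M n) ->
  (forall n, psum (phi1'' nu) j0 n <= t) ->
  (forall N (b : R), exists2 n, (N <= n)%N & b <= mean_upto j0 n) ->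
  forall e, 0 < e -> exists N, forall n, (N <= n)%N ->
    (e * M n)^-1 <= 1 - f_ext nu n.
Proof.
move=> HM Ht Hbig e e0.
have a0 := phi1''_ge0 nu.
pose u n := psum (phi1'' nu) j0 (j0 + n).
have u_nd : nondecreasing_seq u.
  by move=> n k nk; apply: psum_le; rewrite ?leq_addr// leq_add2l.
have u_cv : u @ \oo --> limn u.
  by apply: nondecreasing_is_cvgn => //; exists t => _ [n _ <-]; exact: Ht.
have e2 : 0 < e / 2 by rewrite divr_gt0.
have /cvgrPdist_lt/(_ _ e2)[K _ HK] := u_cv.
exists (j0 + K)%N => n Kn.
have j0n : (j0 <= n)%N by apply: leq_trans Kn; exact: leq_addr.
have [M0 mM] := HM n j0n.
have tail k : (n <= k)%N -> psum (phi1'' nu) j0 k - psum (phi1'' nu) j0 n <= e / 2.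
  move=> nk; have := HK (n - j0)%N; rewrite /= leq_subRL// => /(_ Kn).
  have := nondecreasing_cvgn_le u_nd u_cv (k - j0)%N.
  have := nondecreasing_cvgn_le u_nd u_cv (n - j0)%N.
  rewrite /u !subnKC ?(leq_trans j0n)// => un uk.
  rewrite ger0_norm ?subr_ge0//; lra.
rewrite lerBrDl -lerBrDr; apply: f_ext_le => i.
have [k nik bk] := Hbig (n + i)%N (e / 2)^-1.
have nk : (n <= k)%N by apply: leq_trans nik; exact: leq_addr.
apply: (@le_trans _ _ (phi_comp nu n (k - n) 0)).
  by apply: phi_comp_nd; rewrite leq_subRL.
rewrite lerBrDl -lerBrDr -[leRHS]invrK lef_pV2 ?posrE ?invr_gt0 ?subr_gt0;
  rewrite ?mulr_gt0//; last exact: phi_comp_lt1.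
have := inv_survival_le (k - n) j0n; rewrite subnKC// => H.
apply: (le_trans H).
have mk0 : 0 < mean_upto j0 k by rewrite mean_upto_gt0.
have mn0 : 0 < mean_upto j0 n by rewrite mean_upto_gt0.
have mnk0 : 0 < mean_upto n k by rewrite mean_upto_gt0.
(* the bound from n to k in terms of the tail of the convergent series *)
have -> : psum (phi1'' nu) n k + (mean_upto n k)^-1 = mean_upto j0 n *
   (psum (phi1'' nu) j0 k - psum (phi1'' nu) j0 n + (mean_upto j0 k)^-1).
  rewrite mulrDr (@mean_upto_cat j0 n k) ?j0n// invfM mulrA divff ?gt_eqF// mul1r.
  congr (_ + _); rewrite {2}/psum (big_cat_nat j0n nk)/= addrAC subrr add0r.
  rewrite mulr_sumr; apply: eq_big_nat => l /andP[nl lk].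
  rewrite !mean_prodE (@mean_upto_cat j0 n l.+1) ?j0n ?leqW//.
  have l0 : 0 < phi1' nu l by rewrite mean_gt0// (leq_trans j0n).
  have nl0 : 0 < mean_upto n l.+1 by rewrite mean_upto_gt0.
  by field; rewrite !gt_eqF.
have bk' : (mean_upto j0 k)^-1 <= e / 2.
  by rewrite -[leRHS]invrK lef_pV2 ?posrE ?invr_gt0.
rewrite mulrC; apply: ler_pM => //; first last.
- by have := tail k nk; lra.
- exact: ltW.
- rewrite addr_ge0 ?invr_ge0 ?(ltW mk0)// subr_ge0; exact: psum_le.
Qed.

End positive_means.

End extinction_of_clusters.

(** * Growth of the mean population when d_* is positive *)

Section mean_growth.
Context {R : realType} {m : nat -> nat}.
Variables (beta1 beta2 : R) (mu : forall j, probability ((m j).-tuple R) R)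
  (nu : bool -> forall j, probability ((m j).-tuple bool) R).
Hypotheses (beta1_gt0 : 0 < beta1) (beta2_lt1 : beta2 < 1)
  (mu_cube : forall j, mu j (cube beta1 beta2 (m j)) = 1%E).

Let measurable_cube n : measurable (cube beta1 beta2 n).
Proof.
have -> : cube beta1 beta2 n = \bigcap_(k in [set: 'I_n])
    ((fun l : n.-tuple R => tnth l k) @^-1` `[beta1, beta2]).
  apply/seteqP; split => [l lc k _ /=|l lc k]; first by rewrite in_itv /= lc.
  by have := lc k I; rewrite /= in_itv.
apply: fin_bigcap_measurable => [|k _]; first exact: finite_finset.
by rewrite -[X in measurable X]setTI; apply: measurable_tnth.
Qed.

Let moment (s : R) j (x : (m j).-tuple bool) (l : (m j).-tuple R) : R :=
  \sum_(k < m j) tnth l k `^ s * (tnth x k)%:R.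

Let moment_ge0 s j x l : 0 <= @moment s j x l.
Proof. by rewrite sumr_ge0// => k _; rewrite mulr_ge0// powR_ge0. Qed.

Let measurable_moment s j x : measurable_fun setT (EFin \o @moment s j x).
Proof.
apply/measurable_EFinP; apply: measurable_sum => k.
apply: measurable_funM; last exact: measurable_cst.
apply: (measurableT_comp (measurable_powR _)); exact: measurable_tnth.
Qed.

Lemma alpha_ge0 s j : (0 <= alpha beta1 beta2 mu nu s j)%E.
Proof.
apply: integral_ge0 => x _; apply: integral_ge0 => l _.
by rewrite lee_fin moment_ge0.
Qed.

Lemma alpha0E j : alpha beta1 beta2 mu nu 0 j = (phi1' nu j)%:E.
Proof.
transitivity (\int[nu true j]_x (\sum_(k < m j) (tnth x k)%:R)%:E)%E.
  apply: eq_integral => x _.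
  transitivity (\int[mu j]_(l in cube beta1 beta2 (m j))
      (cst (\sum_(k < m j) (tnth x k)%:R : R)%:E) l)%E.
    apply: eq_integral => l _; congr (_%:E).
    by apply: eq_bigr => k _; rewrite powRr0 mul1r.
  rewrite integral_cst//; last exact: measurable_cube.
  by rewrite [X in (_ * X)%E](mu_cube j) mule1.
rewrite integral_tuple_bool phi1'E; congr (_%:E); apply: eq_bigr => x _.
by rewrite natr_sum mulrC.
Qed.

Lemma alpha_le s j : 0 <= s ->
  (alpha beta1 beta2 mu nu s j <= alpha beta1 beta2 mu nu 0 j)%E.
Proof.
move=> s0; apply: ge0_le_integral => //.
- by move=> x _; apply: integral_ge0 => l _; rewrite lee_fin moment_ge0.
- exact: measurable_fun_tuple_bool.
- exact: measurable_fun_tuple_bool.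
move=> x _; apply: ge0_le_integral.
- exact: measurable_cube.
- by move=> l _; rewrite lee_fin moment_ge0.
- exact: measurable_funTS (measurable_moment _ _).
- exact: measurable_funTS (measurable_moment _ _).
move=> l lc; rewrite lee_fin ler_sum// => k _; rewrite ler_wpM2r//.
have /andP[lk0 lk1] := lc k.
have [l0 l1] : 0 < tnth l k /\ tnth l k <= 1.
  by split; [exact: lt_le_trans lk0|exact: le_trans lk1 (ltW _)].
rewrite powRr0; rewrite -[leRHS](powRr0 (tnth l k)).
by apply: ger_powR; rewrite ?l0.
Qed.

Lemma j_under_mean_gt0 j0 : j_under beta1 beta2 mu nu = Some j0 ->
  forall j, (j0 <= j)%N -> 0 < phi1' nu j.
Proof.
rewrite /j_under; case: pselect => // ex [<-] j.
case: ex_minnP => k /asboolP Hk _ kj.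
by have := Hk j kj; rewrite alpha0E lte_fin.
Qed.

(** Since the ratios are below 1, [rho s <= rho 0] for [s >= 0]; hence
[d_star > 0] forces exponential growth of the mean population. *)
Lemma d_star_gt0_growth : (0 < d_star beta1 beta2 mu nu)%E ->
  exists2 j0, j_under beta1 beta2 mu nu = Some j0 &
    forall N (b : R), exists2 n, (N <= n)%N & b <= mean_upto nu j0 n.
Proof.
rewrite /d_star; case E : j_under => [j0|]; last by rewrite ltNge leNye.
move=> /ereal_sup_gt[_ [s /= rs <-]]; rewrite lte_fin => s0.
exists j0 => // N b.
have mean0 := j_under_mean_gt0 E.
pose S n := \sum_(j0 <= l < n) ln (phi1' nu l).
have [c c0 [n0 Hc]] : exists2 c : R, 0 < c & exists n0, forall n, (n0 <= n)%N ->
    c <= n%:R^-1 * S n.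
  move: rs; rewrite /rho limn_einf_lim => rs.
  set u := (fun j => _) in rs.
  have [n0 un0] : exists n0, (0 < einfs u n0)%E.
    apply: contraPP rs => /forallNP Hn; apply/negP; rewrite -leNgt.
    apply: lime_le; first exact: is_cvg_einfs.
    by apply: nearW => n; rewrite leNgt; apply/negP/Hn.
  have Hu n : (n0 <= n)%N -> (einfs u n0 <= (n%:R^-1 * S n)%:E)%E.
    move=> n0n; apply: (@le_trans _ _ (u n)).
      by apply: ereal_inf_lbound; exists n.
    rewrite /u EFinM lee_wpmul2l ?lee_fin ?invr_ge0// /S -sumEFin.
    rewrite !big_nat; apply: lee_sum => l /andP[j0l _].
    have l0 := mean0 l j0l; rewrite -lne_EFin// lee_lne.
    - by rewrite -alpha0E; exact: alpha_le (ltW s0).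
    - by rewrite in_itv /= alpha_ge0 leey.
    - by rewrite in_itv /= lee_fin ltW// leey.
  move: un0 Hu; case: (einfs u n0) => [c| |] //= un0 Hu.
  - by exists c => //; exists n0 => n /Hu; rewrite lee_fin.
  - by have := Hu n0 (leqnn _); rewrite leye_eq.
have b0 : 0 <= `|b| / c by rewrite divr_ge0// ltW.
pose n := maxn (maxn N n0) (maxn j0 (Num.bound (`|b| / c))).+1.
have [Nn n0n] : (N <= n)%N /\ (n0 <= n)%N.
  by rewrite /n !leq_max !leqnn /= orbT.
have bn : (Num.bound (`|b| / c) <= n)%N.
  by rewrite /n leq_max; apply/orP; right; rewrite leqW// leq_maxr.
have ngt0 : (0 < n)%N by rewrite /n leq_max orbT.
exists n => //; have := Hc n n0n; rewrite mulrC ler_pdivlMr ?ltr0n// => cS.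
have -> : mean_upto nu j0 n = expR (S n).
  rewrite /S expR_sum /mean_upto !big_nat; apply: eq_bigr => l /andP[j0l _].
  by rewrite lnK// posrE mean0.
apply: le_trans (expR_ge1Dx _); apply: (@le_trans _ _ (c * n%:R)); last by lra.
apply: (le_trans (ler_norm b)); rewrite mulrC -ler_pdivrMr//.
by apply: (le_trans (ltW (archi_boundP b0))); rewrite ler_nat.
Qed.

End mean_growth.

(** * Words and live rays *)

Section tree.
Variable m : nat -> nat.
Implicit Types (u v : seq nat) (x : seq nat -> bool) (n s k : nat).

Fixpoint words n : seq (seq nat) :=
  if n is s.+1 then [seq rcons u k | u <- words s, k <- iota 1 (m s)]
  else [:: [::]].

Lemma tree_words_rcons u k : tree_words m 0 (rcons u k) <->
  tree_words m 0 u /\ (1 <= k <= m (size u))%N.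
Proof.
split=> [H|[Hu Hk] i].
  split=> [i iu|].
    have := H i; rewrite size_rcons nth_rcons iu; apply; exact: leqW.
  by have := H (size u); rewrite size_rcons nth_rcons ltnn eqxx; apply.
rewrite size_rcons ltnS leq_eqVlt nth_rcons => /predU1P[->|iu].
  by rewrite ltnn eqxx.
by rewrite iu; exact: Hu.
Qed.

Lemma mem_words n u : u \in words n <-> tree_words m 0 u /\ size u = n.
Proof.
elim: n u => [|n IH] u /=.
  rewrite inE; split=> [/eqP ->|[_ /size0nil ->]]; last exact: eqxx.
  by split=> // i.
split=> [/allpairsP[[v k] /= [/IH[tv <-] + ->]]|[]].
  rewrite mem_iota add1n ltnS => kv; rewrite size_rcons; split => //.
  by apply/tree_words_rcons.
case/lastP: u => // v k /tree_words_rcons[tv kv]; rewrite size_rcons => -[vn].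
apply/allpairsP; exists (v, k); split=> //=; first by apply/IH.
by rewrite mem_iota add1n ltnS -vn.
Qed.

Lemma words_uniq n : uniq (words n).
Proof.
elim: n => [//|n IH]; apply: allpairs_uniq => //; first exact: iota_uniq.
by move=> [u k] [v l] _ _ /= /rcons_inj[-> ->].
Qed.

Lemma size_words n : size (words n) = (\prod_(i < n) m i)%N.
Proof.
elim: n => [|n IH] /=; first by rewrite big_ord0.
by rewrite size_allpairs IH size_iota big_ord_recr.
Qed.

Lemma sum_words_S (F : seq nat -> nat) s :
  (\sum_(v <- words s.+1) F v =
   \sum_(u <- words s) \sum_(k < m s) F (rcons u k.+1))%N.
Proof.
rewrite /= big_allpairs_dep; apply: eq_bigr => u _.
rewrite -[1%N]addn0 iotaDl big_map.
by rewrite -(big_mkord xpredT (fun k => F (rcons u k.+1))) /index_iota subn0.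
Qed.

Lemma tree_words_take u i : tree_words m 0 u -> tree_words m 0 (take i u).
Proof.
move=> tu j; rewrite size_take_min leq_min => /andP[ji ju].
by rewrite nth_take//; exact: tu.
Qed.

(** No condition bears on the prefixes shorter than n, so every word shorter
than n is alive from n. *)
Definition alive x n v : bool :=
  all (fun j => x (take j v)) (iota n ((size v).+1 - n)).

Lemma aliveP x n v :
  reflect (forall j, (n <= j <= size v)%N -> x (take j v)) (alive x n v).
Proof.
apply: (iffP allP) => H j; have := H j; rewrite mem_iota.
  move=> {}H /andP[nj jv]; apply: H; rewrite nj /= subnKC ?ltnS//.
  by rewrite leqW// (leq_trans nj).
move=> {}H /andP[nj]; have [nv|vn] := leqP n (size v).+1.
  by rewrite subnKC// ltnS => jv; apply: H; rewrite nj.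
move: vn => /ltnW; rewrite -subn_eq0 => /eqP ->.
by rewrite addn0 ltnNge nj.
Qed.

Lemma alive_size x n v : size v = n -> alive x n v = x v.
Proof. by move=> <-; rewrite /alive subSnn /= take_size andbT. Qed.

Lemma alive_rcons x n u k : (n <= size u)%N ->
  alive x n (rcons u k) = alive x n u && x (rcons u k).
Proof.
move=> nu; have e : ((size (rcons u k)).+1 - n = (size u).+1 - n + 1)%N.
  by rewrite size_rcons subSn ?leqW// addn1.
rewrite /alive e iotaD all_cat /=.
rewrite subnKC ?(leqW nu)// andbT take_oversize ?size_rcons//; congr (_ && _).
apply: eq_in_all => j; rewrite mem_iota subnKC ?(leqW nu)// ltnS => /andP[_ ju].
by rewrite -cats1 takel_cat.
Qed.

Lemma alive_take x n v i : alive x n v -> alive x n (take i v).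
Proof.
move=> /aliveP H; apply/aliveP => j; rewrite size_take_min leq_min.
by move=> /and3P[nj ji jv]; rewrite take_takel// H// nj.
Qed.

Definition nalive x n s : nat := count (alive x n) (words s).

Lemma nalive_nn x n : nalive x n n = count x (words n).
Proof. by apply: eq_in_count => v /mem_words[_ vn]; rewrite alive_size. Qed.

Lemma nalive_S x n s : (n <= s)%N ->
  (nalive x n s.+1 =
   \sum_(u <- words s | alive x n u) \sum_(k < m s) x (rcons u k.+1))%N.
Proof.
move=> ns; rewrite /nalive -sum1_count big_mkcond sum_words_S [RHS]big_mkcond.
rewrite big_seq [RHS]big_seq; apply: eq_bigr => u /mem_words[_ us].
case: ifPn => au; [|rewrite big1//]; [apply: eq_bigr|] => k _;
  by rewrite alive_rcons ?us// ?au ?(negbTE au)//; case: (x _).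
Qed.

Lemma count_words_S x s :
  (count x (words s.+1) = \sum_(u <- words s) \sum_(k < m s) x (rcons u k.+1))%N.
Proof.
rewrite -sum1_count big_mkcond sum_words_S.
by apply: eq_bigr => u _; apply: eq_bigr => k _; case: (x _).
Qed.

Lemma nalive_gt0 x n s :
  (0 < nalive x n s)%N <-> exists2 v, v \in words s & alive x n v.
Proof. by rewrite -has_count; split=> /hasP. Qed.

Lemma nalive_eq0_leq x n s s' :
  nalive x n s = 0%N -> (s <= s')%N -> nalive x n s' = 0%N.
Proof.
move=> s0 ss'; apply/eqP; rewrite -leqn0 leqNgt; apply/negP.
move=> /nalive_gt0[v /mem_words[tv vs'] av].
have /nalive_gt0 : exists2 v, v \in words s & alive x n v.
  exists (take s v); last exact: alive_take.
  apply/mem_words; split; first exact: tree_words_take.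
  by rewrite size_takel// vs'.
by rewrite s0.
Qed.

(** Koenig's lemma: if there are live words of all lengths, one can extend
letter by letter a prefix that has live extensions of all lengths. *)
Lemma alive_ray x n : (forall s, (0 < nalive x n s)%N) ->
  exists zeta : nat -> nat, forall j,
    mkseq zeta j \in words j /\ alive x n (mkseq zeta j).
Proof.
move=> long.
pose P u := forall k, exists v,
  [/\ v \in words (size u + k), take (size u) v = u & alive x n v].
have P0 : P [::].
  move=> k; have /nalive_gt0[v vk av] := long k.
  by exists v; rewrite take0.
have PS u : exists k, P u -> P (rcons u k).
  apply: contrapT => /forallNP H.
  have Pu : P u by apply: contrapT => nPu; apply: (H 0%N) => /nPu.
  have /choice[K HK] : forall i, exists k, ~ exists v,
      [/\ v \in words (size (rcons u i) + k),
          take (size (rcons u i)) v = rcons u i & alive x n v].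
    by move=> i; apply/existsNP => Pi; exact: (H i).
  pose B := (\sum_(i < (m (size u)).+1) K i)%N.
  have [v [/mem_words[tv vs] vu av]] := Pu B.+1.
  have su : (size u < size v)%N by rewrite vs addnS ltnS leq_addr.
  pose i := nth 0%N v (size u).
  have ui : take (size u).+1 v = rcons u i by rewrite (take_nth 0%N su) vu.
  have iB : (K i <= B)%N.
    have im : (i < (m (size u)).+1)%N by rewrite ltnS; case/andP: (tv _ su).
    by rewrite /B (bigD1 (Ordinal im))//= leq_addr.
  apply: (HK i); exists (take (size u + (K i).+1) v).
  have Kv : (size u + (K i).+1 <= size v)%N by rewrite vs leq_add2l ltnS.
  rewrite size_rcons addSnnS; split; last exact: alive_take.
    apply/mem_words; split; first exact: tree_words_take.
    by rewrite size_takel.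
  by rewrite take_takel ?ui// addnS ltnS leq_addr.
have [f Hf] := choice PS.
pose U := fix U i := if i is i'.+1 then rcons (U i') (f (U i')) else [::].
exists (f \o U) => j.
have UE : mkseq (f \o U) j = U j.
  by elim: j => [//|j IH]; rewrite mkseqS IH.
have PU : P (U j) by elim: j {UE} => [//|j IH]; apply: Hf.
have [v [vw vU av]] := PU 0%N; rewrite UE.
have vE : v = U j.
  by move/mem_words: vw => [_]; rewrite addn0 -{2}vU => <-; rewrite take_size.
have Uj : size (U j) = j by rewrite -UE size_mkseq.
by rewrite -vE; split=> //; move: vw; rewrite addn0 Uj.
Qed.

Lemma subtree_cat u v : tree_words m 0 u -> subtree m u v ->
  tree_words m 0 v /\ (size u <= size v)%N.
Proof.
move=> tu [w tw <-]; rewrite size_cat leq_addr; split => // i.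
rewrite size_cat nth_cat => iuw; case: (ltnP i (size u)) => [|ui]; first exact: tu.
have := tw (i - size u)%N; rewrite subnKC// add0n; apply.
by rewrite ltn_subLR.
Qed.

Lemma Theta_eq0 (R : realType) (dO : measure_display)
    (Omega : measurableType dO) (d : nat)
    (J : seq nat -> Omega -> set 'rV[R]_d) (X : seq nat -> Omega -> bool) w :
  Theta m J X w = set0 <-> forall n, exists k, nalive (X^~ w) n (n + k) = 0%N.
Proof.
split=> [T0 n|H].
  apply: contrapT => /forallNP Hk.
  have [|zeta Hz] := @alive_ray (X^~ w) n.
    move=> s; rewrite lt0n; apply/eqP => ns0; apply: (Hk s).
    by apply: (nalive_eq0_leq ns0); exact: leq_addl.
  suff : Theta m J X w (Defs.limit_point J zeta w) by rewrite T0.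
  exists (mkseq zeta n); first by case/mem_words: (Hz n).1.
  exists zeta => // j; rewrite size_mkseq => nj.
  have [/mem_words[tj sj] /aliveP aj] := Hz j.
  split; last by move=> i; rewrite size_mkseq => ?; apply: aj.
  exists (drop n (mkseq zeta j)); last first.
    have <- : take n (mkseq zeta j) = mkseq zeta n.
      by rewrite /mkseq -map_take take_iota (minn_idPl nj).
    exact: cat_take_drop.
  move=> i; rewrite size_drop !size_mkseq nth_drop => inj.
  by apply: tj; rewrite sj -ltn_subRL.
rewrite -subset0 => p [u tu [zeta zu _]].
have [k nk0] := H (size u).
have su : (size u <= size u + k)%N by exact: leq_addr.
have [sub al] := zu _ su.
have [tz _] := subtree_cat tu sub.
suff /nalive_gt0 : exists2 v, v \in words (size u + k) & alive (X^~ w) (size u) v.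
  by rewrite nk0.
exists (mkseq zeta (size u + k)); last exact/aliveP.
by apply/mem_words; rewrite size_mkseq.
Qed.

End tree.

(** * The branching property *)

Section markov_tree.
Context {R : realType} {dO : measure_display} {Omega : measurableType dO}.
Variables (P : probability Omega R) (m : nat -> nat).
Variable nu : bool -> forall j, probability ((m j).-tuple bool) R.
Variable X : seq nat -> Omega -> bool.
Hypothesis HX : tree_markov_chain P nu X.
Implicit Types (u v : seq nat) (L : seq (seq nat)) (V : set (seq nat))
  (A B : set Omega) (n s k : nat) (z : R).

Let F V := <<s events V X >>.

Let F_setI V A B : F V A -> F V B -> F V (A `&` B).
Proof. exact: (@measurableI _ (g_sigma_algebraType (events V X))). Qed.

Let F_setU V A B : F V A -> F V B -> F V (A `|` B).
Proof. exact: (@measurableU _ (g_sigma_algebraType (events V X))). Qed.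

Let F_set0 V : F V set0.
Proof. exact: (@measurable0 _ (g_sigma_algebraType (events V X))). Qed.

Let F_setT V : F V setT.
Proof. exact: (@measurableT _ (g_sigma_algebraType (events V X))). Qed.

Let F_event V v t : V v -> F V (X v @^-1` [set t]).
Proof. by move=> Vv; apply: sub_sigma_algebra; exists v, [set t]. Qed.

Let F_mono V V' A : V `<=` V' -> F V A -> F V' A.
Proof.
move=> VV'; apply: smallest_sub; first exact: smallest_sigma_algebra.
move=> _ [v [C [Vv mC ->]]]; apply: sub_sigma_algebra.
by exists v, C; split=> //; exact: VV'.
Qed.

Let F_measurable V A : V `<=` tree_words m 0 -> F V A -> measurable A.
Proof.
move=> Vtree; apply: smallest_sub; first exact: sigma_algebra_measurable.
move=> _ [v [C [Vv mC ->]]]; rewrite -[X in measurable X]setTI.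
exact: (mc_measurable HX (Vtree _ Vv)).
Qed.

(** Cutting an event along the labels of the vertices of L, one vertex at a
time, leaves disjoint events on which these labels are fixed. *)
Lemma atom_ind V L (Q : set Omega -> Prop) : [set` L] `<=` V ->
  (forall A B, F V A -> F V B -> [disjoint A & B] -> Q A -> Q B -> Q (A `|` B)) ->
  (forall A c, F V A -> (forall v w, v \in L -> A w -> X v w = c v) -> Q A) ->
  forall A, F V A -> Q A.
Proof.
move=> + QU; elim: L => [|v L IH] LV QA.
  by move=> A FA; apply: (QA A xpredT).
have LV' : [set` L] `<=` V by move=> u uL; apply: LV; rewrite /= inE uL orbT.
have Vv : V v by apply: LV; rewrite /= mem_head.
apply: IH => // A c FA Ac.
pose At t := A `&` X v @^-1` [set t].
have -> : A = At true `|` At false.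
  apply/seteqP; split=> [w Aw|w [[]//|[]//]].
  by rewrite /At; case E : (X v w); [left|right].
have QAt t : Q (At t).
  apply: (QA _ (fun u => if u == v then t else c u)) => [|u w].
    by apply: F_setI => //; exact: F_event.
  rewrite inE => /predU1P[->|uL] [Aw Xt]; first by rewrite eqxx.
  by case: eqP => [->//|_]; exact: Ac.
apply: QU => //; [by apply: F_setI => //; exact: F_event..|].
apply/disj_setPLR => w [_ /= X1] [_ /= X2].
by rewrite X1 in X2.
Qed.

(** Being a function of the labels of L, without naming that function. *)
Definition determined (T : Type) L (H : Omega -> T) : Prop :=
  forall w w', (forall v, v \in L -> X v w = X v w') -> H w = H w'.

Lemma F_determined V L (T : Type) (H : Omega -> T) (Y : set T) :
  [set` L] `<=` V -> determined L H -> F V (H @^-1` Y).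
Proof.
move=> LV dH; rewrite -[X in F V X]setTI.
apply: (@atom_ind V L (fun A => F V (A `&` H @^-1` Y))) => //.
  by move=> A B FA FB _ QA QB; rewrite setIUl; exact: F_setU.
move=> A c FA Ac.
have cst w w' : A w -> A w' -> H w = H w'.
  by move=> Aw Aw'; apply: dH => v vL; rewrite (Ac v w)// (Ac v w').
have [[w [Aw Yw]]|AY] := pselect (exists w, A w /\ Y (H w)).
  suff -> : A `&` H @^-1` Y = A by [].
  by apply/seteqP; split=> [w' []|w' Aw']//; split=> //=; rewrite (cst w' w).
suff -> : A `&` H @^-1` Y = set0 by exact: F_set0.
by rewrite -subset0 => w [Aw Yw]; apply: AY; exists w.
Qed.

Lemma measurable_determined L d (T : measurableType d) (H : Omega -> T) :
  [set` L] `<=` tree_words m 0 -> determined L H -> measurable_fun setT H.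
Proof.
move=> LV dH _ Y mY; rewrite setTI.
by apply: (@F_measurable (tree_words m 0)) => //; exact: F_determined dH.
Qed.

(** The transition law, localised to an event on which the label of u is
fixed, so that no conditional probability remains. *)
Lemma children_prob V B u t (x : (m (size u)).-tuple bool) :
  tree_words m 0 u -> V `<=` tree_words m 0 -> V `&` subtree_star m u = set0 ->
  F V B -> (forall w, B w -> X u w = t) ->
  (P (B `&` children m X u @^-1` [set x]) = P B * (weight nu t x)%:E)%E.
Proof.
move=> tu Vtree Vu FB BX.
have [_ HB] := mc_transition HX [set x] tu.
have FB' : F (tree_words m 0 `\` subtree_star m u) B.
  apply: F_mono FB => v Vv; split; first exact: Vtree.
  by move=> uv; have : (V `&` subtree_star m u) v by []; rewrite Vu.
have mB : measurable B by exact: F_measurable FB.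
rewrite setIC -(HB B FB').
rewrite (eq_integral (cst (nu t (size u) [set x]))); last first.
  by move=> w; rewrite inE => /BX ->.
rewrite integral_cst// muleC /weight fineK//.
by rewrite fin_num_measure//; exact: measurable_tuple_bool.
Qed.

Definition offspring u w : nat := (\sum_(k < m (size u)) X (rcons u k.+1) w)%N.

Let child_list u := [seq rcons u k | k <- iota 1 (m (size u))].

Let child_listP u k : (k < m (size u))%N -> rcons u k.+1 \in child_list u.
Proof. by move=> km; apply/map_f; rewrite mem_iota /= add1n ltnS. Qed.

Let determined_offspring u L : {subset child_list u <= L} ->
  determined L (offspring u).
Proof.
move=> uL w w' H; apply: eq_bigr => k _; rewrite H//.
by apply: uL; exact: child_listP.
Qed.

Let determined_children u : determined (child_list u) (children m X u).
Proof.
move=> w w' H; apply: eq_from_tnth => k; rewrite !tnth_mktuple H//.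
exact: child_listP.
Qed.

Let child_list_tree u : tree_words m 0 u -> [set` child_list u] `<=` tree_words m 0.
Proof.
move=> tu _ /mapP[k + ->]; rewrite mem_iota add1n ltnS => kv.
exact/tree_words_rcons.
Qed.

(** Conditional independence of the offspring of vertices of one generation.
The induction adds the children of one vertex to V: they are not descendants of
the vertices that remain. *)
Lemma integral_offspring s (D : seq (seq nat)) c z V B : 0 <= z ->
  uniq D -> {subset D <= words m s} -> V `<=` tree_words m 0 ->
  (forall u, u \in D -> V `&` subtree_star m u = set0) -> F V B ->
  (forall u w, u \in D -> B w -> X u w = c u) ->
  (\int[P]_(w in B) (\prod_(u <- D) z ^+ offspring u w)%:E =
   P B * (\prod_(u <- D) phi nu (c u) (size u) z)%:E)%E.
Proof.
move=> z0; elim: D V B => [|u D IH] V B.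
  move=> _ _ Vtree _ FB _.
  rewrite (eq_integral (cst 1%E)); last by move=> w _; rewrite big_nil.
  by rewrite integral_cst ?big_nil ?mul1e ?mule1//; exact: F_measurable FB.
move=> /= /andP[uD Duniq] Dsub Vtree VD FB BX.
have /mem_words[tu us] : u \in words m s by apply: Dsub; rewrite mem_head.
pose V' := V `|` [set` child_list u].
have V'tree : V' `<=` tree_words m 0.
  by move=> v [/Vtree//|]; exact: child_list_tree.
have Dtree v : v \in D -> tree_words m 0 v /\ size v = s.
  by move=> vD; apply/mem_words; apply: Dsub; rewrite inE vD orbT.
have V'D v : v \in D -> V' `&` subtree_star m v = set0.
  move=> vD; rewrite setIUl VD ?set0U ?inE ?vD ?orbT//.
  rewrite -subset0 => _ [/mapP[k _ ->] [w [_ w0] uv]].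
  have [_ vs] := Dtree v vD.
  move/(congr1 (take s)): uv; rewrite take_cat vs ltnn subnn take0 cats0.
  rewrite -cats1 take_cat us ltnn subnn take0 cats0 => vu.
  by move: uD; rewrite -vu vD.
(* cut B according to the labels of the children of u *)
pose Bx (x : (m (size u)).-tuple bool) := B `&` children m X u @^-1` [set x].
have FBx x : F V' (Bx x).
  apply: F_setI; first by apply: F_mono FB => v; left.
  apply: (@F_determined V' (child_list u)); last exact: determined_children.
  by move=> v; right.
have mBx x : measurable (Bx x) by exact: F_measurable (FBx x).
have BE : B = \big[setU/set0]_(x <- index_enum _) Bx x.
  rewrite -bigcup_seq; apply/seteqP; split=> [w Bw|w [x _ []]//].
  by exists (children m X u w) => //=; rewrite mem_index_enum.
pose CL := flatten [seq child_list v | v <- D].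
have dR : determined CL (fun w => \prod_(v <- D) z ^+ offspring v w).
  move=> w w' H; apply: eq_big_seq => v vD; congr (_ ^+ _).
  apply: (determined_offspring _ H) => v' vv'.
  by apply/flattenP; exists (child_list v) => //; exact: map_f.
have CLtree : [set` CL] `<=` tree_words m 0.
  move=> v /flattenP[_ /mapP[v' v'D ->]]; apply: child_list_tree.
  by have [] := Dtree v' v'D.
have mR : measurable_fun setT (fun w => \prod_(v <- D) z ^+ offspring v w).
  exact: measurable_determined dR.
have R0 w : 0 <= \prod_(v <- D) z ^+ offspring v w.
  by apply: prodr_ge0 => v _; exact: exprn_ge0.
have mz : measurable_fun setT (fun w => z ^+ offspring u w).
  apply: (@measurable_determined (child_list u)); first exact: child_list_tree.
  by move=> w w' H; rewrite (determined_offspring _ H).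
rewrite [in LHS]BE ge0_integral_bigsetU//=.
- rewrite big_cons phiE.
  transitivity (\sum_x (P B * (weight nu (c u) x)%:E *
      (z ^+ (\sum_(k < m (size u)) tnth x k) *
       \prod_(v <- D) phi nu (c v) (size v) z)%:E)%E)%E.
    apply: eq_bigr => x _.
    transitivity (\int[P]_(w in Bx x) ((z ^+ (\sum_(k < m (size u)) tnth x k))%:E *
        (\prod_(v <- D) z ^+ offspring v w)%:E))%E.
      apply: eq_integral => w; rewrite inE => -[_ /= <-].
      rewrite -EFinM big_cons; congr (_ ^+ _ * _)%:E.
      by apply: eq_bigr => k _; rewrite tnth_mktuple.
    rewrite ge0_integralZl_EFin//; last 3 first.
    - by move=> w _; rewrite lee_fin.
    - by apply/measurable_EFinP; exact: measurable_funTS mR.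
    - exact: exprn_ge0.
    rewrite (IH V')//; last 2 first.
    - by move=> v vD; apply: Dsub; rewrite inE vD orbT.
    - by move=> v w vD [Bw _]; apply: BX => //; rewrite inE vD orbT.
    rewrite (@children_prob V B u (c u))//; last 2 first.
    - by apply: VD; rewrite mem_head.
    - by move=> w Bw; apply: BX => //; rewrite mem_head.
    by rewrite EFinM muleCA.
  have PB : P B \is a fin_num by rewrite fin_num_measure//; exact: F_measurable FB.
  rewrite -(fineK PB) -EFinM mulr_suml mulr_sumr -sumEFin.
  by apply: eq_bigr => x _; rewrite -!EFinM; congr (_%:E); ring.
- exact: index_enum_uniq.
- apply/trivIsetP => x y _ _ /eqP xy; rewrite -subset0.
  by move=> w [[_ /= wx] [_ /= wy]]; apply: xy; rewrite -wx -wy.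
- rewrite -BE; apply/measurable_EFinP/measurable_funTS.
  under eq_fun do rewrite big_cons.
  exact: measurable_funM.
- by move=> w _; rewrite lee_fin prodr_ge0// => v _; exact: exprn_ge0.
Qed.

Let words_upto s := flatten [seq words m i | i <- iota 0 s.+1].

Let words_uptoP s v : v \in words_upto s <-> tree_words m 0 v /\ (size v <= s)%N.
Proof.
split=> [/flattenP[_ /mapP[i + ->]]|[tv vs]].
  by rewrite mem_iota ltnS => /andP[_ is_] /mem_words[tv ->].
apply/flattenP; exists (words m (size v)); last exact/mem_words.
by apply: map_f; rewrite mem_iota ltnS.
Qed.

Let words_upto_tree s : [set` words_upto s] `<=` tree_words m 0.
Proof. by move=> v /words_uptoP[]. Qed.

Let determined_mono s s' (T : Type) (H : Omega -> T) : (s <= s')%N ->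
  determined (words_upto s) H -> determined (words_upto s') H.
Proof.
move=> ss' dH w w' ww'; apply: dH => v /words_uptoP[tv vs].
by apply: ww'; apply/words_uptoP; split=> //; exact: leq_trans ss'.
Qed.

Let mem_words_upto n u : u \in words m n -> u \in words_upto n.
Proof. by move=> /mem_words[tu un]; apply/words_uptoP; rewrite un. Qed.

Let determined_offspring_words s u : u \in words m s ->
  determined (words_upto s.+1) (offspring u).
Proof.
move=> /mem_words[tu us]; apply: determined_offspring => v vu.
by apply/words_uptoP; split; [exact: child_list_tree vu|];
  case/mapP: vu => k _ ->; rewrite size_rcons us.
Qed.

Let integral_setU_determined s (H : Omega -> R) A B : (forall w, 0 <= H w) ->
  determined (words_upto s) H -> measurable A -> measurable B ->
  [disjoint A & B] ->
  (\int[P]_(w in A `|` B) (H w)%:E =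
   \int[P]_(w in A) (H w)%:E + \int[P]_(w in B) (H w)%:E)%E.
Proof.
move=> H0 dH mA mB AB; apply: ge0_integral_setU => //.
- apply/measurable_EFinP/measurable_funTS.
  exact: (measurable_determined (@words_upto_tree s)).
- by move=> w _; rewrite lee_fin.
Qed.

(** On an event where the labels up to generation s are fixed, D and the
right-hand integrand are constant and [integral_offspring] applies. *)
Lemma branching_step s (D : seq nat -> Omega -> bool) z : 0 <= z ->
  (forall u, u \in words m s -> determined (words_upto s) (D u)) ->
  (\int[P]_w (\prod_(u <- words m s | D u w) z ^+ offspring u w)%:E =
   \int[P]_w (\prod_(u <- words m s | D u w) phi nu (X u w) (size u) z)%:E)%E.
Proof.
move=> z0 dD.
pose H1 w := \prod_(u <- words m s | D u w) z ^+ offspring u w.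
pose H2 w := \prod_(u <- words m s | D u w) phi nu (X u w) (size u) z.
have H10 w : 0 <= H1 w by apply: prodr_ge0 => u _; exact: exprn_ge0.
have H20 w : 0 <= H2 w by apply: prodr_ge0 => u _; exact: phi_ge0.
have dH1 : determined (words_upto s.+1) H1.
  move=> w w' ww'; rewrite /H1 big_mkcond [RHS]big_mkcond.
  apply: eq_big_seq => u us; rewrite (determined_offspring_words us ww').
  by rewrite (determined_mono (leqnSn s) (dD u us) ww').
have dH2 : determined (words_upto s) H2.
  move=> w w' ww'; rewrite /H2 big_mkcond [RHS]big_mkcond.
  apply: eq_big_seq => u us; rewrite (dD u us w w' ww') ww'//.
  exact: mem_words_upto.
pose V : set (seq nat) := [set` words_upto s].
have Vtree : V `<=` tree_words m 0 by exact: words_upto_tree.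
apply: (@atom_ind V (words_upto s)
  (fun A => (\int[P]_(w in A) (H1 w)%:E = \int[P]_(w in A) (H2 w)%:E)%E)) => //.
- move=> A B FA FB AB QA QB.
  have mA := F_measurable Vtree FA; have mB := F_measurable Vtree FB.
  rewrite (integral_setU_determined H10 dH1 mA mB AB).
  by rewrite (integral_setU_determined H20 dH2 mA mB AB) QA QB.
move=> A c FA Ac.
have [[w0 Aw0]|A0] := pselect (exists w, A w); last first.
  have -> : A = set0 by rewrite -subset0 => w Aw; apply: A0; exists w.
  by rewrite !integral_set0.
pose D' := [seq u <- words m s | D u w0].
have DE u w : u \in words m s -> A w -> D u w = D u w0.
  by move=> us Aw; apply: dD => // v vs; rewrite (Ac v w)// (Ac v w0).
have -> : (\int[P]_(w in A) (H1 w)%:E =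
    \int[P]_(w in A) (\prod_(u <- D') z ^+ offspring u w)%:E)%E.
  apply: eq_integral => w; rewrite inE => Aw; congr (_%:E).
  rewrite /H1 big_filter big_seq_cond [RHS]big_seq_cond; apply: eq_bigl => u.
  by case us : (u \in words m s) => //=; rewrite (DE u w).
have -> : (\int[P]_(w in A) (H2 w)%:E =
    \int[P]_(w in A) (cst (\prod_(u <- D') phi nu (c u) (size u) z)%:E) w)%E.
  apply: eq_integral => w; rewrite inE => Aw; congr (_%:E).
  rewrite /H2 big_filter big_seq_cond [RHS]big_seq_cond; apply: eq_big => u.
    by case us : (u \in words m s) => //=; rewrite (DE u w).
  by move=> /andP[us _]; rewrite (Ac u w)//; exact: mem_words_upto.
rewrite integral_cst; last exact: F_measurable FA.
rewrite muleC.
apply: (@integral_offspring s D' c z V) => //.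
- by rewrite filter_uniq// words_uniq.
- by move=> u; rewrite mem_filter => /andP[].
- move=> u; rewrite mem_filter => /andP[_ /mem_words[tu us]].
  rewrite -subset0 => t [/words_uptoP[_ ts] [v [_ v0] tE]].
  move: ts; rewrite -tE size_cat us -{2}[s]addn0 leq_add2l leqn0 size_eq0 => /eqP v00.
  by apply: v0; rewrite v00.
- move=> u w; rewrite mem_filter => /andP[_ us] Aw.
  by apply: Ac => //; exact: mem_words_upto.
Qed.

Let prod_cst_count (r : seq (seq nat)) (p : pred (seq nat)) (a : R) :
  \prod_(u <- r | p u) a = a ^+ count p r.
Proof. by rewrite big_const_seq iter_mulr mulr1. Qed.

Let determined_alive n s u : u \in words m s ->
  determined (words_upto s) (fun w => alive (X^~ w) n u).
Proof.
move=> /mem_words[tu us] w w' ww'; apply: eq_all => j; apply: ww'.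
apply/words_uptoP; split; first exact: tree_words_take.
by rewrite size_take_min -us geq_minr.
Qed.

Lemma determined_nalive n s : determined (words_upto s) (fun w => nalive m (X^~ w) n s).
Proof.
move=> w w' ww'; apply: eq_in_count => u us; exact: determined_alive ww'.
Qed.

Let determined_count s : determined (words_upto s) (fun w => count (X^~ w) (words m s)).
Proof.
move=> w w' ww'; apply: eq_in_count => u us; apply: ww'; exact: mem_words_upto.
Qed.

Lemma measurable_count s d (T : measurableType d) (g : nat -> T) :
  measurable_fun setT (fun w => g (count (X^~ w) (words m s))).
Proof.
apply: (measurable_determined (@words_upto_tree s)) => w w' ww'.
by rewrite (determined_count ww').
Qed.

Lemma measurable_nalive n s : measurable [set w | nalive m (X^~ w) n s = 0%N].
Proof.
apply: (@F_measurable (tree_words m 0)) => //.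
exact: (F_determined [set 0%N] (@words_upto_tree s) (@determined_nalive n s)).
Qed.

Let offspringE s u w : u \in words m s ->
  offspring u w = (\sum_(k < m s) X (rcons u k.+1) w)%N.
Proof. by move=> /mem_words[_ <-]. Qed.

(** The live words of generation s + 1 are the children, labelled by a one, of the
live words of generation s. *)
Let nalive_step n s z : (n <= s)%N -> 0 <= z ->
  (\int[P]_w (z ^+ nalive m (X^~ w) n s.+1)%:E =
   \int[P]_w (phi nu true s z ^+ nalive m (X^~ w) n s)%:E)%E.
Proof.
move=> ns z0.
have := @branching_step s (fun u w => alive (X^~ w) n u) z z0 (@determined_alive n s).
move=> H; transitivity (\int[P]_w
    (\prod_(u <- words m s | alive (X^~ w) n u) z ^+ offspring u w)%:E)%E.
  apply: eq_integral => w _; congr (_%:E); rewrite nalive_S//.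
  rewrite big_seq_cond (big_morph _ (exprD z) (expr0 z)) [RHS]big_seq_cond.
  by apply: eq_bigr => u /andP[us _]; rewrite (offspringE w us).
rewrite H; apply: eq_integral => w _; congr (_%:E).
rewrite /nalive -prod_cst_count big_seq_cond [RHS]big_seq_cond.
apply: eq_bigr => u /andP[/mem_words[_ us] /aliveP al].
by rewrite -[u in X u w]take_size al ?us ?ns ?leqnn.
Qed.

Lemma integral_nalive n k z : 0 <= z <= 1 ->
  (\int[P]_w (z ^+ nalive m (X^~ w) n (n + k))%:E =
   \int[P]_w (phi_comp nu n k z ^+ count (X^~ w) (words m n))%:E)%E.
Proof.
elim: k z => [|k IH] z z01.
  by rewrite addn0; apply: eq_integral => w _; rewrite nalive_nn.
have /andP[z0 z1] := z01.
rewrite addnS nalive_step ?leq_addr// IH ?phi_compSr//.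
by rewrite phi_ge0// phi_le1.
Qed.

Lemma integral_count_S s z : 0 <= z ->
  (\int[P]_w (z ^+ count (X^~ w) (words m s.+1))%:E =
   \int[P]_w (phi nu false s z ^+ count (predC (X^~ w)) (words m s) *
     phi nu true s z ^+ count (X^~ w) (words m s))%:E)%E.
Proof.
move=> z0.
have := @branching_step s (fun _ _ => true) z z0 (fun _ _ _ _ _ => erefl) => H.
transitivity (\int[P]_w (\prod_(u <- words m s) z ^+ offspring u w)%:E)%E.
  apply: eq_integral => w _; congr (_%:E); rewrite count_words_S.
  rewrite big_seq_cond (big_morph _ (exprD z) (expr0 z)) [RHS]big_seq_cond.
  by apply: eq_bigr => u /andP[us _]; rewrite (offspringE w us).
rewrite H; apply: eq_integral => w _; congr (_%:E).
rewrite (bigID (X^~ w)) mulrC /=; congr (_ * _); rewrite -prod_cst_count.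
  rewrite big_seq_cond [RHS]big_seq_cond.
  by apply: eq_bigr => u /andP[/mem_words[_ us]]; rewrite us /=; case: (X u w).
rewrite big_seq_cond [RHS]big_seq_cond.
by apply: eq_bigr => u /andP[/mem_words[_ us]]; rewrite us /=; case: (X u w).
Qed.

(** The event that the clusters of ones started from generation n, and hence
also those started earlier, are finite. *)
Definition clusters_finite n : set Omega :=
  \bigcup_k [set w | nalive m (X^~ w) n (n + k) = 0%N].

Lemma measurable_clusters_finite n : measurable (clusters_finite n).
Proof. by apply: bigcup_measurable => k _; exact: measurable_nalive. Qed.

(** At [z = 0], [integral_nalive] is the probability that the clusters
started from generation n die out within k generations; let k tend to
infinity. *)
Lemma prob_clusters_finite n :
  P (clusters_finite n) =
    (\int[P]_w (f_ext nu n ^+ count (X^~ w) (words m n))%:E)%E.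
Proof.
pose E k := [set w | nalive m (X^~ w) n (n + k) = 0%N].
have E_cvg : P (E k) @[k --> \oo] --> P (clusters_finite n).
  apply: nondecreasing_cvg_mu.
  - by move=> k; exact: measurable_nalive.
  - exact: measurable_clusters_finite.
  - move=> k l kl; apply/subsetPset => w Ek.
    by apply: nalive_eq0_leq Ek _; rewrite leq_add2l.
(* 0 ^+ i is 1 for i = 0 and 0 otherwise *)
have PE k : P (E k) =
    (\int[P]_w (phi_comp nu n k 0 ^+ count (X^~ w) (words m n))%:E)%E.
  rewrite -integral_nalive ?lexx ?ler01// -[E k]setIT -integral_indic//; last first.
    exact: measurable_nalive.
  apply: eq_integral => w _; congr (_%:E); rewrite expr0n indicE.
  case: eqP => wE; first by rewrite mem_set.
  by rewrite memNset.
have I_cvg := @cvg_monotone_convergence _ _ _ P setT measurableT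
  (fun k w => (phi_comp nu n k 0 ^+ count (X^~ w) (words m n))%:E).
have c01 k : 0 <= phi_comp nu n k 0 <= 1 by apply: phi_comp01; rewrite lexx ler01.
apply: (cvg_unique _ E_cvg) => //.
rewrite (eq_integral (fun w => limn (fun k =>
    (phi_comp nu n k 0 ^+ count (X^~ w) (words m n))%:E))); last first.
  move=> w _; apply/esym/cvg_lim => //; apply: cvg_EFin; first exact: nearW.
  exact: (continuous_cvg _ (@exprn_continuous _ _ _) (@phi_comp_cvg _ _ nu n)).
rewrite (funext PE); apply: I_cvg.
- move=> k; apply/measurable_EFinP.
  exact: (@measurable_count n _ _ (fun c => phi_comp nu n k 0 ^+ c)).
- by move=> k w _; rewrite lee_fin exprn_ge0//; case/andP: (c01 k).
- move=> w _ k l kl; rewrite lee_fin lerXn2r ?nnegrE//.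
  + by case/andP: (c01 k).
  + by case/andP: (c01 l).
  + exact: phi_comp_nd.
Qed.

Lemma clusters_finite_S n : clusters_finite n.+1 `<=` clusters_finite n.
Proof.
move=> w [k _ /= Hk]; exists k.+1 => //=; rewrite addnS -addSn.
apply/eqP; rewrite -leqn0 -{}Hk; apply: sub_count => v /aliveP H.
by apply/aliveP => j /andP[nj jv]; apply: H; rewrite jv (ltnW nj).
Qed.

Lemma Theta_eq0_clusters (d : nat) (J : seq nat -> Omega -> set 'rV[R]_d) :
  [set w | Theta m J X w = set0] = \bigcap_n clusters_finite n.
Proof.
apply/seteqP; split=> [w /Theta_eq0 H n _|w H]; last apply/Theta_eq0 => n.
  by have [k Hk] := H n; exists k.
by have [k _ Hk] := H n I; exists k.
Qed.

End markov_tree.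

(** * Comparison of the series *)

Section sigma_bounds.
Context {R : realType} {m : nat -> nat}.
Variables (beta1 beta2 : R) (mu : forall j, probability ((m j).-tuple R) R)
  (nu : bool -> forall j, probability ((m j).-tuple bool) R).
Hypothesis mu_cube : forall j, mu j (cube beta1 beta2 (m j)) = 1%E.
Variable j0 : nat.
Hypothesis j_underE : j_under beta1 beta2 mu nu = Some j0.

Lemma sigma_under_bound j : (j0 <= j)%N ->
  0 <= 1 - fine (sigma_under beta1 beta2 mu nu j)^-1 <= f_ext nu j.
Proof.
move=> j0j; rewrite /sigma_under /before_j_under j_underE ltnNge j0j /=.
exact: (sigma_le_f_ext (j_under_mean_gt0 mu_cube j_underE)).
Qed.

Lemma sigma_over_bound j :
  f_ext nu j <= 1 - fine (sigma_over beta1 beta2 mu nu j)^-1 <= 1.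
Proof.
rewrite /sigma_over /before_j_under j_underE; case: ltnP => j0j.
  by rewrite invey /= subr0 f_ext_le1 lexx.
exact: (f_ext_le_sigma (j_under_mean_gt0 mu_cube j_underE)).
Qed.

End sigma_bounds.

Section series_terms.
Context {R : realType} {m : nat -> nat}.
Variable nu : bool -> forall j, probability ((m j).-tuple bool) R.
Hypothesis Hf : forall j, 0 < f_ext nu j.
Let M n : nat := (\prod_(i < n) m i)%N.

(** The probability that the clusters of ones started from the children of a
given zero of generation j are all finite. *)
Definition zero_finite j : R := phi nu false j (f_ext nu j.+1).

Lemma zero_finite_gt0 j : 0 < zero_finite j.
Proof. exact: phi_gt0. Qed.

Lemma zero_finite_le1 j : zero_finite j <= 1.
Proof. by apply: phi_le1; rewrite f_ext_ge0 f_ext_le1. Qed.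

Definition log_term j : R := (M j)%:R * - ln (zero_finite j).

Lemma series_term_ge0 (sigma : nat -> \bar R) j :
  0 <= 1 - fine (sigma j.+1)^-1 <= 1 -> (0 <= series_term nu sigma j)%E.
Proof.
move=> s01; apply: mule_ge0; first by rewrite lee_fin.
by rewrite oppe_ge0 lne_le0 lee_fin phi_le1.
Qed.

Lemma series_term_ge (sigma : nat -> \bar R) j :
  0 <= 1 - fine (sigma j.+1)^-1 <= f_ext nu j.+1 ->
  ((log_term j)%:E <= series_term nu sigma j)%E.
Proof.
move=> /andP[s0 s1]; rewrite /log_term EFinM lee_wpmul2l ?lee_fin//.
rewrite EFinN leeN2 -lne_EFin ?zero_finite_gt0// lee_lne ?in_itv/=
  ?lee_fin ?leey ?phi_ge0//.
- exact: phi_le.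
- by rewrite ltW// zero_finite_gt0.
Qed.

Lemma series_term_le (sigma : nat -> \bar R) j :
  f_ext nu j.+1 <= 1 - fine (sigma j.+1)^-1 ->
  (series_term nu sigma j <= (log_term j)%:E)%E.
Proof.
move=> s1; rewrite /log_term EFinM lee_wpmul2l ?lee_fin//.
have s0 : 0 <= 1 - fine (sigma j.+1)^-1 by exact: le_trans (ltW (Hf _)) s1.
rewrite EFinN leeN2 -lne_EFin ?zero_finite_gt0// lee_lne ?in_itv/=
  ?lee_fin ?leey ?phi_ge0//.
- by apply: phi_le => //; exact: ltW.
- by rewrite ltW// zero_finite_gt0.
Qed.

End series_terms.

(** * The probability that all clusters are finite *)

Section finite_clusters_probability.
Context {R : realType} {dO : measure_display} {Omega : measurableType dO}.
Variables (P : probability Omega R) (m : nat -> nat).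
Variable nu : bool -> forall j, probability ((m j).-tuple bool) R.
Variable X : seq nat -> Omega -> bool.
Hypothesis HX : tree_markov_chain P nu X.
Hypothesis Hf : forall j, 0 < f_ext nu j.
Hypothesis m_gt0 : forall j, (0 < m j)%N.

Let M n : nat := (\prod_(i < n) m i)%N.
Let N n w : nat := count (X^~ w) (words m n).
Let Z n w : nat := count (predC (X^~ w)) (words m n).
Let f := f_ext nu.
Let c := zero_finite nu.
Let y n : R := fine (P (clusters_finite m X n)).

Let NZ n w : (N n w + Z n w = M n)%N.
Proof. by rewrite /N /Z /M -size_words -(count_predC (X^~ w)). Qed.

Let f0 n : 0 <= f n. Proof. exact: f_ext_ge0. Qed.
Let f1 n : f n <= 1. Proof. exact: f_ext_le1. Qed.
Let c0 n : 0 < c n. Proof. exact: zero_finite_gt0. Qed.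
Let c1 n : c n <= 1. Proof. exact: zero_finite_le1. Qed.

Let yE n : P (clusters_finite m X n) = (y n)%:E.
Proof.
by rewrite fineK// fin_num_measure//; exact: measurable_clusters_finite HX n.
Qed.

Let y_int n : (y n)%:E = (\int[P]_w (f n ^+ N n w)%:E)%E.
Proof. by rewrite -yE (prob_clusters_finite HX). Qed.

Let y_rec n : (y n.+1)%:E = (\int[P]_w (c n ^+ Z n w * f n ^+ N n w)%:E)%E.
Proof. by rewrite y_int (integral_count_S HX) ?f0// -f_ext_rec. Qed.

Let mf n : measurable_fun setT (fun w => f n ^+ N n w).
Proof. exact: (measurable_count HX n (fun k => f n ^+ k)). Qed.

Let mZf n : measurable_fun setT (fun w => c n ^+ Z n w * f n ^+ N n w).
Proof.
have -> : (fun w => c n ^+ Z n w * f n ^+ N n w) =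
    (fun w => c n ^+ (M n - N n w) * f n ^+ N n w).
  by apply/funext => w; rewrite -(NZ n w) addKn.
exact: (measurable_count HX n (fun k => c n ^+ (M n - k) * f n ^+ k)).
Qed.

Let Zf0 n w : 0 <= c n ^+ Z n w * f n ^+ N n w.
Proof. by rewrite mulr_ge0// exprn_ge0// ltW. Qed.

Let y_ge0 n : 0 <= y n.
Proof. by rewrite fine_ge0. Qed.

Let y_le1 n : y n <= 1.
Proof.
by rewrite -lee_fin -yE probability_le1//; exact: measurable_clusters_finite HX n.
Qed.

Let integral_cstP (r : R) : (\int[P]_w r%:E = r%:E)%E.
Proof. by rewrite integral_cst// [X in (_ * X)%E](probability_setT P) mule1. Qed.

Let y_lower n : f n ^+ M n <= y n.
Proof.
rewrite -lee_fin y_int -[leLHS]integral_cstP; apply: ge0_le_integral => //.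
- by move=> w _; rewrite lee_fin exprn_ge0.
- exact/measurable_EFinP.
- move=> w _; rewrite lee_fin; apply: ler_wiXn2l => //.
  by rewrite -(NZ n w) leq_addr.
Qed.

Let y_step_ge n : c n ^+ M n * y n <= y n.+1.
Proof.
rewrite -lee_fin EFinM y_int y_rec -ge0_integralZl_EFin//; last 3 first.
- by move=> w _; rewrite lee_fin exprn_ge0.
- exact/measurable_EFinP.
- by rewrite exprn_ge0// ltW.
apply: ge0_le_integral => //.
- by move=> w _; rewrite -EFinM lee_fin mulr_ge0// exprn_ge0// ltW.
- by apply: measurable_funeM; exact/measurable_EFinP.
- exact/measurable_EFinP.
move=> w _; rewrite -EFinM lee_fin ler_wpM2r ?exprn_ge0//.
by apply: ler_wiXn2l; rewrite ?(ltW (c0 n))// -(NZ n w) leq_addl.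
Qed.

(** Either at least half of the vertices of generation n are ones, and then
[f n ^+ N n w <= f n ^+ h], or at least half are zeros, and then
[c n ^+ Z n w <= c n ^+ h]. *)
Let y_step_le n (h := uphalf (M n)) :
  y n.+1 + (1 - c n ^+ h) * y n <= y n + (1 - c n ^+ h) * f n ^+ h.
Proof.
have ch1 : c n ^+ h <= 1 by rewrite exprn_ile1// ltW.
have ch0 : 0 <= 1 - c n ^+ h by rewrite subr_ge0.
have lin (G H : Omega -> R) : measurable_fun setT G -> measurable_fun setT H ->
    (forall w, 0 <= G w) -> (forall w, 0 <= H w) ->
    (\int[P]_w (G w + (1 - c n ^+ h) * H w)%:E =
     \int[P]_w (G w)%:E + (1 - c n ^+ h)%:E * \int[P]_w (H w)%:E)%E.
  move=> mG mH G0 H0; rewrite -ge0_integralZl_EFin//; last 2 first.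
  - by move=> w _; rewrite lee_fin.
  - exact/measurable_EFinP.
  rewrite -ge0_integralD//.
  - by move=> w _; rewrite lee_fin.
  - exact/measurable_EFinP.
  - by move=> w _; rewrite -EFinM lee_fin mulr_ge0.
  - by apply: measurable_funeM; exact/measurable_EFinP.
have fN0 w : 0 <= f n ^+ N n w by exact: exprn_ge0.
have fh0 : 0 <= f n ^+ h by exact: exprn_ge0.
rewrite -lee_fin [leLHS]EFinD [leRHS]EFinD !EFinM y_rec y_int.
rewrite -[X in (_ <= _ + _ * X)%E]integral_cstP -!lin//.
apply: ge0_le_integral => //.
- by move=> w _; rewrite lee_fin addr_ge0// mulr_ge0.
- by apply/measurable_EFinP/measurable_funD => //; exact: measurable_funM.
- by apply/measurable_EFinP/measurable_funD => //; exact: measurable_funM.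
move=> w _; rewrite lee_fin.
have Mh : (M n <= h + h)%N by rewrite /h addnn uphalf_half; lia.
have [Nh|hN] := leqP h (N n w).
  rewrite lerD//.
    by rewrite ler_piMl// exprn_ile1// ltW.
  by rewrite ler_wpM2l// ler_wiXn2l.
rewrite -lerBlDr -addrA -mulrBr mulrBl mul1r.
have : c n ^+ Z n w <= c n ^+ h.
  by rewrite ler_wiXn2l ?(ltW (c0 n))//; have := NZ n w; lia.
move=> /(ler_wpM2r (fN0 w)); have := mulr_ge0 ch0 fh0; lra.
Qed.

Let E := \bigcap_n clusters_finite m X n.

Let mE : measurable E.
Proof.
apply: bigcap_measurableType => n _; exact: measurable_clusters_finite HX n.
Qed.

Let cvg_y : (y n)%:E @[n --> \oo] --> P E.
Proof.
have -> : (fun n => (y n)%:E) = P \o clusters_finite m X.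
  by apply/funext => n; rewrite /= yE.
apply: nonincreasing_cvg_mu => //.
- rewrite (le_lt_trans (probability_le1 _ _)) ?ltry//.
  exact: measurable_clusters_finite HX 0.
- exact: measurable_clusters_finite HX.
- apply/nonincreasing_seqP => n; apply/subsetPset; exact: clusters_finite_S.
Qed.

(** The product of the factors of [y_step_ge] is the exponential of minus the
partial sum of the series. *)
Lemma clusters_finite_gt0 j B :
  (forall n, (j <= n)%N -> \sum_(j <= l < n) log_term nu l <= B) -> (0 < P E)%E.
Proof.
move=> HB; have lower n : (j <= n)%N ->
    expR (- \sum_(j <= l < n) log_term nu l) * y j <= y n.
  elim: n => [|n IH].
    by rewrite leqn0 => /eqP ->; rewrite big_geq// oppr0 expR0 mul1r.
  rewrite leq_eqVlt => /predU1P[<-|].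
    by rewrite big_geq// oppr0 expR0 mul1r.
  rewrite ltnS => jn; apply: le_trans (y_step_ge n).
  rewrite big_nat_recr//= opprD expRD [X in X * _]mulrC -mulrA.
  have -> : expR (- log_term nu n) = c n ^+ M n.
    by rewrite /log_term mulrN opprK expRM_natl lnK ?posrE.
  by rewrite ler_wpM2l ?exprn_ge0 ?(ltW (c0 n))// IH.
have yj : 0 < y j by apply: lt_le_trans (y_lower j); rewrite exprn_gt0// Hf.
apply: (@lt_le_trans _ _ (expR (- B) * y j)%:E).
  by rewrite lte_fin mulr_gt0// expR_gt0.
rewrite -(cvg_lim _ cvg_y)//; apply: lime_ge; first by apply/cvg_ex; exists (P E).
exists j => // n /= jn; rewrite lee_fin; apply: le_trans (lower n jn).
by rewrite ler_wpM2r// ler_expR lerN2 HB.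
Qed.

(** For large n, [f n ^+ h] is at most half the limit of the probabilities, so
that [y_step_le] bounds [1 - c n ^+ h], and then [- ln (c n)], by a multiple of
[y n - y n.+1]; these differences telescope. *)
Lemma clusters_finite_summable : (0 < P E)%E ->
  (forall e, 0 < e -> exists K, forall n, (K <= n)%N ->
     (e * (M n)%:R)^-1 <= 1 - f n) ->
  exists K B, forall n, (K <= n)%N -> \sum_(K <= l < n) log_term nu l <= B.
Proof.
move=> PE Hlarge; pose x := fine (P E).
have xE : P E = x%:E by rewrite fineK// fin_num_measure.
have x0 : 0 < x by rewrite -lte_fin -xE.
have xy n : x <= y n.
  rewrite -lee_fin -xE -yE; apply: le_measure; rewrite ?inE//.
    exact: measurable_clusters_finite HX n.
  by move=> w; apply.
have x40 : 0 < x / 4 by rewrite divr_gt0.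
(* with e = x / 4, f n ^+ uphalf (M n) <= x / 2 for n >= K *)
have [K HK] := Hlarge _ x40.
exists K, ((8 / x ^+ 2)) => n Kn.
have M0 l : 0 < (M l)%:R :> R by rewrite ltr0n prodn_gt0.
have key l : (K <= l)%N -> log_term nu l <= 8 / x ^+ 2 * (y l - y l.+1).
  move=> Kl; pose h := uphalf (M l).
  have Mh : (M l)%:R <= 2 * h%:R :> R.
    by rewrite -natrM ler_nat /h uphalf_half; lia.
  have fh : f l ^+ h <= x / 2.
    have := @exprn_survival_le _ (f l) h; rewrite f0 f1 => /(_ isT) H.
    have hA : 2 / x <= h%:R * (1 - f l).
      have -> : 2 / x = (M l)%:R / 2 * (x / 4 * (M l)%:R)^-1.
        by field; rewrite !gt_eqF.
      apply: ler_pM; rewrite ?divr_ge0 ?invr_ge0 ?mulr_ge0 ?(ltW x0)//.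
        by rewrite ler_pdivrMr// mulrC.
      exact: HK.
    have fh0 : 0 <= f l ^+ h by exact: exprn_ge0.
    have -> : x / 2 = 1 / (2 / x) by field; rewrite gt_eqF.
    rewrite ler_pdivlMr ?divr_gt0//; have := ler_wpM2l fh0 hA; lra.
  have q0 : 0 < c l ^+ h by rewrite exprn_gt0.
  have q1 : c l ^+ h <= 1 by rewrite exprn_ile1// ltW.
  have Hstep : y l.+1 + (1 - c l ^+ h) * y l <= y l + (1 - c l ^+ h) * f l ^+ h.
    exact: y_step_le.
  have lnq : h%:R * - ln (c l) <= (c l ^+ h)^-1 - 1.
    have -> : h%:R * - ln (c l) = ln (1 + ((c l ^+ h)^-1 - 1)).
      by rewrite addrC subrK lnV ?posrE// lnXn// mulrN mulr_natl.
    by apply: le_ln1Dx; rewrite ltrBrDr addNr invr_gt0.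
  have lnc : 0 <= - ln (c l) by rewrite oppr_ge0 ln_le0.
  have Mln : log_term nu l <= 2 * ((c l ^+ h)^-1 - 1).
    apply: (@le_trans _ _ (2 * (h%:R * - ln (c l)))); last by rewrite ler_pM2l.
    by rewrite mulrA; apply: ler_wpM2r.
  move: (c l ^+ h) (f l ^+ h) (y l) (y l.+1) Hstep q0 q1 fh Mln {lnq}
    (exprn_ge0 h (f0 l)) (xy l) (xy l.+1) (y_le1 l).
  move=> q p y0 y1 Hstep q0 q1 px Mln p0 xy0 xy1 y01.
  (* q = c l ^+ h, p = f l ^+ h <= x / 2, y0 = y l, y1 = y l.+1 *)
  have qx : x / 2 <= q.
    have := ler_wpM2l (ltW q0) y01; have : q * p >= 0 by rewrite mulr_ge0// ltW.
    lra.
  have dx : (1 - q) * (x / 2) <= y0 - y1.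
    have d0 : 0 <= 1 - q by rewrite subr_ge0.
    have : x / 2 <= y0 - p by lra.
    move=> /(ler_wpM2l d0); lra.
  apply: (le_trans Mln).
  have -> : q^-1 - 1 = (1 - q) / q by field; rewrite gt_eqF.
  have -> : 8 / x ^+ 2 * (y0 - y1) = 2 * ((y0 - y1) / (x / 2) / (x / 2)).
    by field; rewrite gt_eqF.
  rewrite ler_pM2l// ler_pdivrMr//.
  have x2 : 0 < x / 2 by rewrite divr_gt0.
  rewrite -(ler_pdivlMr _ _ x2) in dx.
  have D0 : 0 <= (y0 - y1) / (x / 2) by apply: le_trans dx; rewrite subr_ge0.
  apply: (le_trans dx); rewrite mulrAC -mulrA ler_peMr//.
  by rewrite ler_pdivlMr// mul1r.
apply: (@le_trans _ _ (\sum_(K <= l < n) 8 / x ^+ 2 * (y l - y l.+1))).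
  by rewrite !big_nat; apply: ler_sum => l /andP[Kl _]; exact: key.
rewrite -mulr_sumr -[leRHS]mulr1 ler_wpM2l ?divr_ge0 ?sqr_ge0//.
have -> : \sum_(K <= l < n) (y l - y l.+1) = y K - y n.
  rewrite -[RHS]opprB -telescope_sumr// -sumrN.
  by apply: eq_bigr => l _; rewrite opprB.
have := y_le1 K; have := y_ge0 n; lra.
Qed.

End finite_clusters_probability.

(** * Emptiness of the limit set *)

Theorem proposition2 (R : realType) (dO : measure_display)
    (Omega : measurableType dO) (P : probability Omega R)
    (m : nat -> nat) (m_ge2 : forall j, (2 <= m j)%N)
    (d : nat) (d_ge1 : (1 <= d)%N)
    (beta1 beta2 : R) (beta1_gt0 : 0 < beta1) (beta12 : beta1 <= beta2)
    (beta2_lt1 : beta2 < 1)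
    (mu : forall j, probability ((m j).-tuple R) R)
    (mu_cube : forall j, mu j (cube beta1 beta2 (m j)) = 1%E)
    (J : seq nat -> Omega -> set 'rV[R]_d)
    (HJ : random_compacts P mu J)
    (nu : bool -> forall j, probability ((m j).-tuple bool) R)
    (X : seq nat -> Omega -> bool)
    (HX : tree_markov_chain P nu X)
    (HXL : independent_sigma P (events (tree_words m 0) X)
             (events (tree_words_star m 0) (diam_ratio J)))
    (Hd : (0 <= d_star beta1 beta2 mu nu)%E)
    (Hf : forall j, 0 < f_ext nu j) :
  ((exists j0 : nat,
      (\sum_(j0 <= j <oo)
         series_term nu (sigma_under beta1 beta2 mu nu) j < +oo)%E) ->
   (0 < P [set w | Theta m J X w = set0])%E)
  /\
  ((0 < P [set w | Theta m J X w = set0])%E ->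
   d_star beta1 beta2 mu nu = 0%E \/
   (\sum_(0 <= j <oo)
      series_term nu (sigma_over beta1 beta2 mu nu) j < +oo)%E).
Proof.
have j_ex : exists j0, j_under beta1 beta2 mu nu = Some j0.
  by move: Hd; rewrite /d_star; case: j_under => [j0|//] _; exists j0.
have [js Ejs] := j_ex.
have m_gt0 j : (0 < m j)%N by exact: ltnW.
have mean_gt0 := j_under_mean_gt0 mu_cube Ejs.
rewrite (Theta_eq0_clusters m X J); split.
- move=> [j0 sum_fin]; pose t := series_term nu (sigma_under beta1 beta2 mu nu).
  have t0 j : (0 <= t j)%E.
    apply: series_term_ge0; have [jsj|jjs] := leqP js j.+1.
      have /andP[-> H] := sigma_under_bound mu_cube Ejs jsj.
      exact: le_trans H (f_ext_le1 nu _).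
    by rewrite /sigma_under /before_j_under Ejs jjs invey /= subr0 lexx ler01.
  (* sigma_under is compared with f_ext only from js on *)
  pose j1 := maxn j0 js.
  apply: (@clusters_finite_gt0 _ _ _ P m nu X HX Hf j1
    (fine (\sum_(j0 <= j <oo) t j)%E)) => n j1n.
  have tot0 : (0 <= \sum_(j0 <= j <oo) t j)%E by apply: nneseries_ge0.
  rewrite -lee_fin fineK ?ge0_fin_numE//.
  have j0j1 : (j0 <= j1)%N by exact: leq_maxl.
  apply: le_trans (nneseries_lim_ge n (fun k _ _ => t0 k)).
  rewrite (big_cat_nat j0j1 j1n) /= -sumEFin.
  apply: (@le_trans _ _ (\sum_(j1 <= j < n) t j)%E); last first.
    by rewrite leeDr// sume_ge0.
  rewrite !big_nat; apply: lee_sum => l /andP[j1l _].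
  apply: series_term_ge => //; apply: (sigma_under_bound mu_cube Ejs).
  by rewrite leqW// (leq_trans _ j1l)// leq_maxr.
- move=> P0; have [d0|d0] := eqVneq (d_star beta1 beta2 mu nu) 0%E; [by left|right].
  have dgt0 : (0 < d_star beta1 beta2 mu nu)%E by rewrite lt_neqAle eq_sym d0.
  pose t := series_term nu (sigma_over beta1 beta2 mu nu).
  have sb j := sigma_over_bound mu_cube Ejs j.
  have t0 j : (0 <= t j)%E.
    apply: series_term_ge0; have /andP[H ->] := sb j.+1.
    by rewrite (le_trans _ H)// f_ext_ge0.
  have tle j : (t j <= (log_term nu j)%:E)%E.
    by apply: series_term_le => //; case/andP: (sb j.+1).
  (* if every sigma_over is infinite, each term is a multiple of log 1 *)
  have [[n0 jsn0 s_fin]|s_inf] := pselect (exists2 n0, (js <= n0)%N &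
      (sigma_over beta1 beta2 mu nu n0 < +oo)%E); last first.
    rewrite eseries0 ?ltry// => j _ _; rewrite /series_term.
    have -> : sigma_over beta1 beta2 mu nu j.+1 = +oo%E.
      have [jsj|jjs] := leqP js j.+1; last first.
        by rewrite /sigma_over /before_j_under Ejs jjs.
      apply/eqP; rewrite -leye_eq leNgt; apply/negP => s_fin.
      by apply: s_inf; exists j.+1.
    by rewrite invey [fine 0]/= subr0 phi_at1 lne1 oppe0 mule0.
  have n0_gt0 n : (n0 <= n)%N -> 0 < phi1' nu n.
    by move=> n0n; apply: mean_gt0; exact: leq_trans n0n.
  have a0 n : (n0 <= n)%N -> 0 <= phi1'' nu n / (phi1' nu n * mean_prod nu n0 n).
    move=> n0n; rewrite divr_ge0 ?phi1''_ge0// mulr_ge0 ?phi1'_ge0//.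
    by rewrite mean_prodE ltW// (mean_upto_gt0 n0_gt0).
  pose T := (\sum_(n0 <= n <oo)
      (phi1'' nu n / (phi1' nu n * mean_prod nu n0 n))%:E)%E.
  have T0 : (0 <= T)%E by apply: nneseries_ge0 => n n0n _; rewrite lee_fin a0.
  have Tfin : T \is a fin_num.
    rewrite ge0_fin_numE//; apply: le_lt_trans s_fin.
    rewrite /sigma_over /before_j_under Ejs ltnNge jsn0 /= leeDl//.
    apply: (@le_limn_einf _ _ _ n0) => n n0n.
    by rewrite lee_fin invr_ge0 mean_prodE ltW// (mean_upto_gt0 n0_gt0).
  have psumT n : psum nu (phi1'' nu) n0 n <= fine T.
    rewrite -lee_fin fineK// -sumEFin.
    by apply: nneseries_lim_ge => l n0l _; rewrite lee_fin a0.
  have [js' Ejs' grow] := d_star_gt0_growth beta1_gt0 beta2_lt1 mu_cube dgt0.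
  have ? : js' = js by move: Ejs'; rewrite Ejs => -[].
  subst js'.
  have grow0 N (b : R) : exists2 n, (N <= n)%N & b <= mean_upto nu n0 n.
    have c0 : 0 < mean_upto nu js n0 by exact: (mean_upto_gt0 mean_gt0).
    have [n Nn bn] := grow (maxn N n0) (mean_upto nu js n0 * b).
    move: Nn; rewrite geq_max => /andP[Nn n0n]; exists n => //.
    by move: bn; rewrite (@mean_upto_cat _ _ _ js n0 n) ?jsn0// ler_pM2l.
  have mean_le n : (n0 <= n)%N ->
      0 < ((\prod_(i < n) m i)%N)%:R :> R /\
      mean_upto nu n0 n <= ((\prod_(i < n) m i)%N)%:R.
    move=> n0n; rewrite ltr0n prodn_gt0//; split => //.
    rewrite -(big_mkord xpredT m) (big_cat_nat (leq0n n0) n0n) /= natrM.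
    apply: (@le_trans _ _ (\prod_(n0 <= i < n) m i)%:R).
      rewrite natr_prod /mean_upto; apply: ler_prod => i _.
      by rewrite phi1'_ge0 phi1'_le.
    by rewrite ler_peMl// ler1n big_nat prodn_cond_gt0.
  have large := survival_large n0_gt0 mean_le psumT grow0.
  have [K [B HB]] := clusters_finite_summable HX Hf m_gt0 P0 large.
  apply: (@le_lt_trans _ _ (\sum_(0 <= l < K) log_term nu l + B)%:E);
    last exact: ltry.
  apply: lime_le; first by apply: is_cvg_nneseries.
  exists K => // n /= Kn.
  rewrite (big_cat_nat (leq0n K) Kn) /= EFinD leeD//.
    by rewrite -sumEFin; apply: lee_sum => l _; exact: tle.
  apply: (@le_trans _ _ (\sum_(K <= l < n) log_term nu l)%:E).
    by rewrite -sumEFin; apply: lee_sum => l _; exact: tle.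
  by rewrite lee_fin HB.
Qed.
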